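(* For any infinite odometer $(Y,S)$, there exists a minimal subshift $X_V\subseteq2^{\mathbb{Z}}$ of symbolic rank $2$ such that $(Y,S)$ is the maximal equicontinuous factor of $(X_V,\sigma)$.
   Context: **Dynamical systems.** A topological dynamical system $(X,T)$ is a homeomorphism $T$ of a compact metrizable space $X$. $(Y,S)$ is a factor of $(X,T)$ if there is a factor map, i.e. a continuous surjection $\varphi:X\to Y$ with $\varphi T=S\varphi$; a conjugacy is a factor map that is a homeomorphism. $(X,T)$, with compatible metric $\rho$, is equicontinuous if for all $\epsilon>0$ there is $\delta>0$ such that $\rho(x,y)<\delta$ implies $\rho(T^nx,T^ny)<\epsilon$ for all $n\in\mathbb{Z}$. The maximal equicontinuous factor of $(X,T)$ is an equicontinuous factor $(Y,S)$ with factor map $\varphi$ such that for every equicontinuous factor $(Z,G)$ with factor map $\psi$ there is a factor map $\theta:(Y,S)\to(Z,G)$ with $\psi=\theta\circ\varphi$. **Odometers.** A Cantor system is a homeomorphism of a Cantor space; it is essentially minimal if it has a unique minimal set (nonempty closed invariant set, minimal among such sets). A Bratteli diagram $(V,E)$ consists of vertices $V=V_0\sqcup V_1\sqcup\cdots$ and edges $E=E_1\sqcup E_2\sqcup\cdots$, all $V_n,E_n$ finite nonempty, $V_0=\{v_0\}$, with maps $\mathsf{s},\mathsf{r}:E\to V$ satisfying $\mathsf{s}(E_n)=V_{n-1}$ and $\mathsf{r}(E_n)=V_n$ for $n\ge1$. It is ordered if it carries a partial order $\preceq$ on $E$ in which $e,e'$ are comparable iff $\mathsf{r}(e)=\mathsf{r}(e')$.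 Let $X_B=\{(e_n)_{n\ge1}: e_n\in E_n,\ \mathsf{r}(e_n)=\mathsf{s}(e_{n+1})\}$ with the subspace topology of $\prod_n E_n$. $B$ is essentially simple if there are a unique $x_{\max}\in X_B$ with all edges $\preceq$-maximal and a unique $x_{\min}\in X_B$ with all edges $\preceq$-minimal. The Vershik map $\lambda_B$ sends $x_{\max}$ to $x_{\min}$, and $(e_1,e_2,\dots)\ne x_{\max}$ to $(f_1,\dots,f_k,e_{k+1},\dots)$, where $k$ is least with $e_k$ not maximal, $f_k$ is the $\preceq$-successor of $e_k$, and $(f_1,\dots,f_{k-1})$ is the unique path of minimal edges from $v_0$ to $\mathsf{s}(f_k)$. An infinite odometer is an essentially minimal Cantor system of topological rank $1$, i.e. one conjugate to some $(X_B,\lambda_B)$ with $B$ essentially simple and $|V_n|=1$ for all $n\ge1$; equivalently, an equicontinuous minimal Cantor system. **Symbolic rank.** $2^{\mathbb{Z}}=\{0,1\}^{\mathbb{Z}}$, $\sigma(x)(n)=x(n+1)$. A subshift is a closed $X\subseteq2^{\mathbb{Z}}$ with $\sigma X=X$; it is minimal if every orbit is dense in $X$. For $V\in\{0,1\}^{\mathbb{N}}$, $X_V=\{x\in 2^{\mathbb{Z}}:$ every finite subword of $x$ is a subword of $V\}$. Let $\mathcal{F}$ be the set of finite $0,1$-words that begin and end with $0$. For finite $S\subseteq\mathcal{F}$ and $w\in\mathcal{F}$, a building of $w$ from $S$ consists of $v_1,\dots,v_{k+1}\in S$ and nonnegative integers $s_1,\dots,s_k$, $k\ge 1$, with $w=v_1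 1^{s_1}v_2\cdots v_k1^{s_k}v_{k+1}$; then $w$ is built from $S$ starting with $v_1$. For $n\ge1$, a rank-$n$ generating sequence is a family $\{v_{i,j}\}_{i\ge0,1\le j\le n_i}$ of finite words such that for all $i\ge 0$: $n_i\le n$; $v_{0,j}=0$ for all $1\le j\le n_0$; $v_{i+1,1}$ is built from $S_i=\{v_{i,1},\dots,v_{i,n_i}\}$ starting with $v_{i,1}$; and $v_{i+1,j}$ is built from $S_i$ for all $2\le j\le n_{i+1}$. A rank-$n$ construction is such a sequence together with one chosen building of each $v_{i+1,j}$ from $S_i$ (that of $v_{i+1,1}$ starting with $v_{i,1}$); it is a construction of the infinite word $V=\lim_i v_{i,1}$. The symbolic rank of a subshift $X$ is the smallest $n\ge 1$ (if any) such that $X=X_V$ for some $V$ having a rank-$n$ construction. *)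

(* Defs.v *)
From HB Require Import structures.
From mathcomp Require Import all_boot all_order all_algebra.
From mathcomp Require Import all_classical all_reals topology cantor.

Set Implicit Arguments.
Unset Strict Implicit.
Unset Printing Implicit Defensive.

Import Order.TTheory GRing.Theory Num.Theory.

Local Open Scope classical_set_scope.
Local Open Scope ring_scope.

Record homeo (X Y : topologicalType) := Homeo {
  hfun :> X -> Y;
  hinv : Y -> X;
  hfunK : cancel hfun hinv;
  hinvK : cancel hinv hfun;
  hfun_continuous : continuous hfun;
  hinv_continuous : continuous hinv }.

Definition iterz (X : topologicalType) (T : homeo X X) (n : int) : X -> X :=
  match n with
  | Posz m => iter m T
  | Negz m => iter m.+1 (hinv T)
  end.

Definition orbitz (X : topologicalType) (T : homeo X X) (x : X) : set X :=
  range (fun n => iterz T n x).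

Section Restriction.
Variables (X : topologicalType) (T : homeo X X) (A : set X).
Hypothesis TA : T @` A = A.

Fact restr_fun_subproof (x : A) : T (\val x) \in A.
Proof. by apply/mem_set; move: (imageP T (set_valP x)); rewrite TA. Qed.

Fact restr_inv_subproof (x : A) : hinv T (\val x) \in A.
Proof.
have : (T @` A) (\val x) by rewrite TA; exact: set_valP.
by case=> y Ay <-; rewrite hfunK; exact/mem_set.
Qed.

Definition restr_fun (x : A) : A := exist _ (T (\val x)) (restr_fun_subproof x).

Definition restr_inv (x : A) : A :=
  exist _ (hinv T (\val x)) (restr_inv_subproof x).

Fact restr_funK : cancel restr_fun restr_inv.
Proof. by move=> x; apply: val_inj; rewrite /= hfunK. Qed.

Fact restr_invK : cancel restr_inv restr_fun.
Proof. by move=> x; apply: val_inj; rewrite /= hinvK. Qed.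

Fact restr_fun_continuous : continuous restr_fun.
Proof.
apply: (@continuous_comp_initial _ _ _ set_val) => x.
apply: (@continuous_comp A X X set_val T); last exact: hfun_continuous.
exact: initial_continuous.
Qed.

Fact restr_inv_continuous : continuous restr_inv.
Proof.
apply: (@continuous_comp_initial _ _ _ set_val) => x.
apply: (@continuous_comp A X X set_val (hinv T)); last exact: hinv_continuous.
exact: initial_continuous.
Qed.

Definition restr : homeo A A :=
  Homeo restr_funK restr_invK restr_fun_continuous restr_inv_continuous.

End Restriction.

Section Systems.
Variable R : realType.

Definition compatible_metric (X : topologicalType) (rho : X -> X -> R) : Prop :=
  [/\ forall x y, rho x y = 0 <-> x = y,
      forall x y, rho x y = rho y x,
      forall x y z, rho x z <= rho x y + rho y z &
      forall x (A : set X),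
        nbhs x A <-> exists2 e, 0 < e & [set y | rho x y < e] `<=` A].

Definition metrizable (X : topologicalType) : Prop :=
  exists rho : X -> X -> R, compatible_metric rho.

Definition dynamical_system (X : topologicalType) (T : homeo X X) : Prop :=
  compact [set: X] /\ metrizable X.

(* On a compact space the choice of the compatible metric is immaterial. *)
Definition equicontinuous_system (X : topologicalType) (T : homeo X X) : Prop :=
  dynamical_system T /\
  exists2 rho : X -> X -> R, compatible_metric rho &
    forall eps, 0 < eps -> exists2 delta, 0 < delta &
      forall x y, rho x y < delta ->
        forall n : int, rho (iterz T n x) (iterz T n y) < eps.

Definition factor_map (X Y : topologicalType) (T : homeo X X) (S : homeo Y Y)
    (phi : X -> Y) : Prop :=
  [/\ continuous phi, range phi = [set: Y] & forall x, phi (T x) = S (phi x)].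

Definition maximal_equicontinuous_factor (X Y : topologicalType)
    (T : homeo X X) (S : homeo Y Y) : Prop :=
  [/\ dynamical_system T, equicontinuous_system S &
      exists2 phi : X -> Y, factor_map T S phi &
        forall (Z : topologicalType) (G : homeo Z Z) (psi : X -> Z),
          equicontinuous_system G -> factor_map T G psi ->
          exists2 theta : Y -> Z, factor_map S G theta & psi = theta \o phi].

End Systems.

Definition conjugate (X Y : topologicalType) (T : homeo X X) (S : homeo Y Y) :
    Prop :=
  exists h : homeo X Y, factor_map T S h.

Definition minimal_set (X : topologicalType) (T : homeo X X) (M : set X) : Prop :=
  let closed_invariant (N : set X) := [/\ N !=set0, closed N & T @` N = N] in
  closed_invariant M /\
  forall N, closed_invariant N -> N `<=` M -> N = M.

Definition cantor_system (X : topologicalType) (T : homeo X X) : Prop :=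
  inhabited (homeo X cantor_space).

Definition essentially_minimal (X : topologicalType) (T : homeo X X) : Prop :=
  exists! M : set X, minimal_set T M.

(* [edge n] is E_(n+1). Edges with different levels have different ranges, so
   the partial order on E amounts to one partial order on each level. *)
Record bratteli := Bratteli {
  vertex : nat -> finType;
  edge : nat -> finType;
  src : forall n, edge n -> vertex n;
  tgt : forall n, edge n -> vertex n.+1;
  edge_le : forall n, rel (edge n);
  vertex_nonempty : forall n, (0 < #|vertex n|)%N;
  edge_nonempty : forall n, (0 < #|edge n|)%N;
  vertex0 : #|vertex 0| = 1%N;
  src_surj : forall n (v : vertex n), exists e, src e = v;
  tgt_surj : forall n (v : vertex n.+1), exists e : edge n, tgt e = v;
  edge_le_refl : forall n, reflexive (@edge_le n);
  edge_le_anti : forall n, antisymmetric (@edge_le n);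
  edge_le_trans : forall n, transitive (@edge_le n);
  edge_comparable : forall n (e e' : edge n),
    (edge_le e e' || edge_le e' e) = (tgt e == tgt e') }.

Section Vershik.
Variable B : bratteli.

Definition edge_max n (e : edge B n) : Prop :=
  forall e', edge_le e e' -> e' = e.

Definition edge_min n (e : edge B n) : Prop :=
  forall e', edge_le e' e -> e' = e.

Definition edge_lt n (e e' : edge B n) : bool := (e != e') && edge_le e e'.

Definition edge_succ n (e f : edge B n) : Prop :=
  edge_lt e f /\ forall g, ~~ (edge_lt e g && edge_lt g f).

Definition edge_seq : topologicalType :=
  prod_topology (fun n => discrete_topology (edge B n)).

Definition path_set : set edge_seq :=
  [set x | forall n, tgt (x n : edge B n) = src (x n.+1 : edge B n.+1)].

Definition path_space : topologicalType := set_type path_set.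

Definition pedge (x : path_space) (n : nat) : edge B n := (\val x : edge_seq) n.

Definition path_max (x : path_space) : Prop := forall n, edge_max (pedge x n).

Definition path_min (x : path_space) : Prop := forall n, edge_min (pedge x n).

Definition essentially_simple : Prop :=
  (exists! x, path_max x) /\ (exists! x, path_min x).

(* When [B] is essentially simple these conditions determine [lambda]: the
   first k edges of [lambda x] are minimal and, as [lambda x] is a path, lead
   to the source of its edge k. *)
Definition vershik_map (lambda : path_space -> path_space) : Prop :=
  (forall x, path_max x -> path_min (lambda x)) /\
  (forall x k, ~ edge_max (pedge x k) ->
    (forall j, (j < k)%N -> edge_max (pedge x j)) ->
    [/\ edge_succ (pedge x k) (pedge (lambda x) k),
        forall j, (j < k)%N -> edge_min (pedge (lambda x) j) &
        forall j, (k < j)%N -> pedge (lambda x) j = pedge x j]).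

End Vershik.

Definition infinite_odometer (Y : topologicalType) (S : homeo Y Y) : Prop :=
  [/\ cantor_system S, essentially_minimal S &
      exists B : bratteli,
        [/\ essentially_simple B,
            forall n, #|vertex B n.+1| = 1%N &
            exists2 lambda : homeo (path_space B) (path_space B),
              vershik_map lambda & conjugate S lambda]].

Definition biseq : topologicalType := prod_topology (fun _ : int => bool).

Definition shift_fun (x : biseq) : biseq := fun n => x (n + 1).

Definition shift_inv (x : biseq) : biseq := fun n => x (n - 1).

Fact shift_funK : cancel shift_fun shift_inv.
Proof. by move=> x; apply/funext => n; rewrite /shift_inv /shift_fun subrK. Qed.

Fact shift_invK : cancel shift_inv shift_fun.
Proof. by move=> x; apply/funext => n; rewrite /shift_inv /shift_fun addrK. Qed.

Fact reindex_continuous (u : int -> int) :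
  continuous ((fun x n => x (u n)) : biseq -> biseq).
Proof.
move=> x; apply/cvg_sup => i.
move: x; apply: (@continuous_comp_initial biseq biseq bool
  (fun f : biseq => f i) (fun x n => x (u n))) => x.
exact: (@proj_continuous int (fun=> bool) (u i)).
Qed.

Definition shift : homeo biseq biseq :=
  Homeo shift_funK shift_invK
    (@reindex_continuous (fun n => n + 1)) (@reindex_continuous (fun n => n - 1)).

Record subshift (X : set biseq) : Prop := Subshift {
  subshift_closed : closed X;
  subshift_invariant : shift @` X = X }.

Definition subshift_map (X : set biseq) (hX : subshift X) : homeo X X :=
  restr (subshift_invariant hX).

Definition minimal_subshift (X : set biseq) : Prop :=
  subshift X /\ forall x, X x -> X `<=` closure (orbitz shift x).

(* The letters 0 and 1 are [false] and [true]. *)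
Definition word := seq bool.

Definition subword_at (V : nat -> bool) (m len : nat) : word :=
  mkseq (fun k => V (m + k)%N) len.

Definition bi_subword_at (x : biseq) (m : int) (len : nat) : word :=
  mkseq (fun k => x (m + k%:Z)) len.

Definition X_of (V : nat -> bool) : set biseq :=
  [set x | forall m len, exists m', bi_subword_at x m len = subword_at V m' len].

Definition calF (w : word) : bool :=
  [&& w != [::], ~~ head true w & ~~ last true w].

(* [bld_rest] is the list of the pairs (s_i, v_(i+1)) for 1 <= i <= k. *)
Record building (S : seq word) (w : word) := Building {
  bld_first : word;
  bld_rest : seq (nat * word);
  bld_calF : all calF S && calF w;
  bld_first_in : bld_first \in S;
  bld_rest_in : all (fun p => p.2 \in S) bld_rest;
  bld_rest_nonempty : bld_rest != [::];
  bld_eq :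
    w = bld_first ++ flatten [seq nseq p.1 true ++ p.2 | p <- bld_rest] }.

Definition word_level (size : nat -> nat) (v : nat -> nat -> word) (i : nat) :
  seq word := [seq v i j | j <- iota 1 (size i)].

(* [gs_word i j] is v_(i,j), relevant only for 1 <= j <= [gs_size i]. *)
Record rank_generating_sequence (n : nat) := RankGeneratingSequence {
  gs_size : nat -> nat;
  gs_word : nat -> nat -> word;
  gs_size_bounds : forall i, (1 <= gs_size i <= n)%N;
  gs_word0 : forall j, (1 <= j <= gs_size 0)%N -> gs_word 0 j = [:: false];
  gs_first_built : forall i,
    exists b : building (word_level gs_size gs_word i) (gs_word i.+1 1),
      bld_first b = gs_word i 1;
  gs_built : forall i j, (2 <= j <= gs_size i.+1)%N ->
    inhabited (building (word_level gs_size gs_word i) (gs_word i.+1 j)) }.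

Record rank_construction (n : nat) := RankConstruction {
  rc_seq :> rank_generating_sequence n;
  rc_building : forall i j, (1 <= j <= gs_size rc_seq i.+1)%N ->
    building (word_level (gs_size rc_seq) (gs_word rc_seq) i)
             (gs_word rc_seq i.+1 j);
  rc_first : forall i (h : (1 <= 1 <= gs_size rc_seq i.+1)%N),
    bld_first (rc_building h) = gs_word rc_seq i 1 }.

(* The words v_(i,1) are prefixes of one another with lengths increasing to
   infinity; their limit is the infinite word having all of them as prefixes. *)
Definition construction_of (n : nat) (C : rank_construction n)
    (V : nat -> bool) : Prop :=
  forall i, gs_word C i 1 = subword_at V 0 (size (gs_word C i 1)).

Definition has_rank_construction (n : nat) (X : set biseq) : Prop :=
  exists V, (exists C : rank_construction n, construction_of C V) /\ X = X_of V.

Definition symbolic_rank (X : set biseq) (n : nat) : Prop :=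
  [/\ (1 <= n)%N, has_rank_construction n X &
      forall m, (1 <= m)%N -> has_rank_construction m X -> (n <= m)%N].

(* Main.v *)
Require Import Defs.
From mathcomp Require Import all_boot all_order all_algebra.
From mathcomp Require Import all_classical all_reals topology.
From mathcomp Require Import cantor zify.

(* The odometer is the inverse limit of cyclic groups Z/P_i, where P_0 = 1 and
   P_i divides P_(i+1) >= 3 P_i. Let X_V be the Toeplitz subshift in which level
   i fills all places of the current hole class modulo P_i, except one class
   modulo P_(i+1), with the letter (i mod 2). The word V is generated by two
   words of each length P_i, which differ only at the hole of level i, so the
   rank is at most 2.

   A window of a point of X_V determines its phase modulo P_i, which defines the
   factor map onto the odometer. Two points with the same phases differ in at
   most one place; they are therefore asymptotic and have the same image in every
   equicontinuous factor.

   In a rank-1 subshift every point is a concatenation of copies of a word v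
   containing a 1, separated by spacers 1^s. In X_V all the 1s of a point are
   congruent modulo P_1 >= 3, which makes s constant and the point periodic;
   but the points of X_V are not periodic. *)

Set Implicit Arguments.
Unset Strict Implicit.
Unset Printing Implicit Defensive.

Import Order.TTheory GRing.Theory Num.Theory.

Local Open Scope classical_set_scope.
Local Open Scope ring_scope.

(** * Words of rank one *)

Definition spaced (v : word) (ss : seq nat) : word :=
  v ++ flatten [seq nseq s true ++ v | s <- ss].

Lemma spaced_cons v s ss : spaced v (s :: ss) = v ++ nseq s true ++ spaced v ss.
Proof. by rewrite /spaced /= -!catA. Qed.

Lemma spaced_cat v ss1 s ss2 :
  spaced v (ss1 ++ s :: ss2) = spaced v ss1 ++ nseq s true ++ spaced v ss2.
Proof. by rewrite /spaced map_cat flatten_cat /= -!catA. Qed.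

Lemma spaced_spaced v ss ss2 : exists2 ss', (size ss + size ss2 <= size ss')%N &
  spaced (spaced v ss) ss2 = spaced v ss'.
Proof.
elim: ss2 => [|s ss2 [ss' le_ss' E]].
  by exists ss; rewrite ?addn0 // {1}/spaced cats0.
exists (ss ++ s :: ss'); first by rewrite size_cat /=; lia.
by rewrite spaced_cons E spaced_cat.
Qed.

(** The place where copy [k] of [v], counted from 0, begins in [spaced v ss]. *)
Definition start (v : word) (ss : seq nat) (k : nat) : nat :=
  sumn [seq (size v + s)%N | s <- take k ss].

Lemma startS v ss k : (k < size ss)%N ->
  start v ss k.+1 = (start v ss k + size v + nth 0%N ss k)%N.
Proof.
move=> ks; rewrite /start (take_nth 0%N ks) map_rcons -cats1 sumn_cat /=.
by rewrite addn0 addnA.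
Qed.

Lemma spaced_split v ss k : (k < size ss)%N -> exists2 w,
    size w = start v ss k &
  spaced v ss = w ++ v ++ nseq (nth 0%N ss k) true ++ spaced v (drop k.+1 ss).
Proof.
elim: ss k => [//|s ss IH] [_|k /IH[w sw E]].
  by exists [::]; rewrite //= spaced_cons drop0.
exists (v ++ nseq s true ++ w).
  by rewrite !size_cat size_nseq sw /start /= addnA.
by rewrite spaced_cons E -!catA.
Qed.

Lemma nth_spaced_word v ss k j : (k < size ss)%N -> (j < size v)%N ->
  nth false (spaced v ss) (start v ss k + j) = nth false v j.
Proof.
move=> ks jv; have [w sw ->] := spaced_split v ks.
by rewrite nth_cat sw ltnNge leq_addr /= addKn nth_cat jv.
Qed.

Lemma nth_spaced_spacer v ss k j : (k < size ss)%N -> (j < nth 0%N ss k)%N ->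
  nth false (spaced v ss) (start v ss k + size v + j) = true.
Proof.
move=> ks js; have [w sw ->] := spaced_split v ks.
rewrite -addnA nth_cat sw ltnNge leq_addr /= addKn.
rewrite nth_cat ltnNge leq_addr /= addKn.
by rewrite nth_cat size_nseq js nth_nseq js.
Qed.

Lemma start_ge v ss k : (0 < size v)%N -> (k <= size ss)%N ->
  (k <= start v ss k)%N.
Proof.
move=> v0; elim: k => [//|k IH ks]; rewrite startS //.
by have := IH (ltnW ks); lia.
Qed.

Lemma start_locate v ss t : (0 < size v)%N -> (t.+1 < size ss)%N ->
  exists k, [/\ (k.+1 < size ss)%N, (start v ss k <= t)%N &
    (t < start v ss k.+1)%N].
Proof.
move=> v0 ts.
suff loc k : (k <= t.+1)%N -> (t < start v ss k)%N -> exists k, [/\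
    (k.+1 < size ss)%N, (start v ss k <= t)%N & (t < start v ss k.+1)%N].
  by apply: (loc t.+1 (leqnn _)); exact: start_ge v0 (ltnW ts).
elim: k => [|k IH] kt tk; first by rewrite /start take0 in tk.
have [le|lt] := leqP (start v ss k) t; first by exists k; split => //; lia.
by apply: IH => //; exact: ltnW.
Qed.

Lemma size_spaced_ge v ss : (0 < size v)%N -> (size ss <= size (spaced v ss))%N.
Proof.
move=> v0; elim: ss => [//|s ss IH]; rewrite spaced_cons 2!size_cat.
by rewrite [size (_ :: _)]/=; lia.
Qed.

(* Consecutive copies of [v] in [x] are separated by at most one [1], as two
   adjacent [1]s are not congruent modulo [q]; a common [1] of these copies then
   determines the spacing modulo [q], hence completely. *)
Lemma spaced_periodic (q : nat) (x : int -> bool) (V : nat -> bool) v p :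
  (1 < q)%N -> nth false v p ->
  (forall m n, x m -> x n -> (q %| m - n)%Z) -> X_of V (x : biseq) ->
  (forall N, exists2 ss, (N <= size ss)%N &
     spaced v ss = subword_at V 0 (size (spaced v ss))) ->
  exists2 per, (0 < per)%N & forall n, x (n + per%:Z) = x n.
Proof.
move=> q1 vp ones Xx dec.
have pv : (p < size v)%N.
  by rewrite ltnNge; apply/negP => /(nth_default _) e; rewrite e in vp.
have v0 : (0 < size v)%N by exact: leq_ltn_trans pv.
have qdiv (d : nat) : (q %| d)%N -> (q %| d.+1)%N -> False.
  by move=> d0; rewrite -addn1 dvdn_addr // dvdn1; lia.
(* Neighbouring copies begin at distance [size v] or [(size v).+1], and [q] divides this distance
   but cannot divide both numbers. *)
exists (if (q %| size v)%N then size v else (size v).+1); first by case: ifP.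
set per := (if _ then _ else _) => n.
have perv : (size v <= per <= (size v).+1)%N by rewrite /per; case: ifP; lia.
(* The window starts early enough to contain the beginning of the copy at [n] and is long enough for
   the next two copies. *)
pose len := (4 * size v + 10)%N.
have [m hm] := Xx (n - (size v).+1%:Z) len.
pose t := (m + (size v).+1)%N.
have xV (k : nat) : (m <= k < m + len)%N -> V k = x (n - t%:Z + k%:Z).
  move=> /andP[mk km].
  have := congr1 (nth false ^~ (k - m)%N) hm; rewrite !nth_mkseq; [|lia|lia].
  by rewrite subnKC // => <-; congr (x _); rewrite /t; lia.
have onesV (a b : nat) : (m <= a < m + len)%N -> (m <= b < m + len)%N ->
    (a <= b)%N -> V a -> V b -> (q %| b - a)%N.
  move=> ha hb ab; rewrite !xV // => xa xb.
  have := ones _ _ xb xa; rewrite dvdzE /=; congr (_ %| _)%N; lia.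
have [ss Nss E] := dec (m + len + 2)%N.
have sV k : (k < m + len)%N -> V k = nth false (spaced v ss) k.
  move=> km; rewrite E nth_mkseq //.
  by apply: leq_trans (size_spaced_ge _ v0); lia.
have [|k [kss kt tk]] := @start_locate v ss t v0.
  by rewrite /t /len in Nss *; lia.
have wordV i j : (i < size ss)%N -> (j < size v)%N ->
    (start v ss i + j < m + len)%N -> V (start v ss i + j)%N = nth false v j.
  by move=> iss jv lt; rewrite sV // nth_spaced_word.
have spacerV i j : (i < size ss)%N -> (j < nth 0 ss i)%N ->
    (start v ss i + size v + j < m + len)%N ->
    V (start v ss i + size v + j)%N = true.
  by move=> iss js lt; rewrite sV // nth_spaced_spacer.
have adj a : (m <= a)%N -> (a.+1 < m + len)%N -> V a -> V a.+1 -> False.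
  move=> ma aS Va Va1; have := onesV a a.+1 _ _ (leqnSn _) Va Va1.
  by rewrite subSnn dvdn1; lia.
have kss' := ltnW kss.
have tlen : (t + 3 * size v + 8 <= m + len)%N by rewrite /t /len; lia.
rewrite (startS _ kss') in tk.
(* Further inside the spacer, [t.-1] and [t] would be adjacent letters 1. *)
have ct : (t <= start v ss k + size v)%N.
  rewrite leqNgt; apply/negP => lt.
  pose j := (t - (start v ss k + size v)).-1%N.
  apply: (adj t.-1); rewrite ?prednK; try by rewrite /t; lia.
    have -> : t.-1 = (start v ss k + size v + j)%N by rewrite /j; lia.
    by apply: spacerV; rewrite /j; lia.
  have -> : t = (start v ss k + size v + j.+1)%N by rewrite /j; lia.
  by apply: spacerV; rewrite /j; lia.
(* Letter [p] of copy [i] and of copy [i.+1] is a 1, so the distance between these copies is a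
   multiple of [q]. *)
have small i : (i < size ss)%N -> (t <= start v ss i + size v)%N ->
    (start v ss i <= t + size v + 1)%N -> (i.+1 < size ss)%N ->
    (nth 0%N ss i <= 1)%N /\ (size v + nth 0 ss i)%N = per.
  move=> iss lo hi iss'.
  have s1 : (nth 0%N ss i <= 1)%N.
    rewrite leqNgt; apply/negP => s2.
    apply: (adj (start v ss i + size v)%N); try by rewrite /t in lo *; lia.
      by rewrite -[X in V X]addn0 spacerV //; lia.
    by rewrite -[X in V X.+1]addn0 -addnS spacerV //; lia.
  split=> //.
  have := onesV (start v ss i + p)%N (start v ss i.+1 + p)%N.
  rewrite !wordV ?startS //; try by lia.
  rewrite vp => /(_ _ _ _ isT isT).
  have -> : (start v ss i + size v + nth 0 ss i + p - (start v ss i + p) =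
    size v + nth 0 ss i)%N by lia.
  move=> h; have {}h : (q %| size v + nth 0 ss i)%N.
    by apply: h; rewrite /t in lo *; lia.
  rewrite /per; case: ifP => [dv|ndv].
    case: (nth _ _ _) s1 h => [|[]] //; rewrite ?addn0 // addn1 => _.
    by move=> /(qdiv _ dv).
  by case: (nth _ _ _) s1 h => [|[]] //; rewrite ?addn0 ?addn1 ?ndv.
have kt' : (k <= t)%N by exact: leq_trans (start_ge v0 (ltnW kss')) kt.
have kss2 : (k.+2 < size ss)%N by lia.
have [_ ek] : (nth 0%N ss k <= 1)%N /\ (size v + nth 0 ss k)%N = per.
  by apply: small => //; lia.
have startk : start v ss k.+1 = (start v ss k + per)%N.
  by rewrite startS // -addnA ek.
have [_ ek1] : (nth 0%N ss k.+1 <= 1)%N /\ (size v + nth 0 ss k.+1)%N = per.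
  by apply: small => //; rewrite startk; lia.
have -> : x n = V t by rewrite xV; [congr (x _)|rewrite /t]; lia.
have -> : x (n + per%:Z) = V (t + per)%N.
  by rewrite xV; [congr (x _)|rewrite /t in tlen *]; lia.
have [lt|ge] := ltnP t (start v ss k + size v).
  have -> : t = (start v ss k + (t - start v ss k))%N by lia.
  by rewrite addnAC -startk !wordV //; lia.
(* Here [t] is the single spacer place after copy [k]; by [ek] and [ek1], copy [k.+1] has a spacer
   of the same length. *)
have te : t = (start v ss k + size v + 0)%N by lia.
rewrite te addn0 addnAC -startk -[X in _ = V X]addn0 -[X in V X = _]addn0.
by rewrite !spacerV //; lia.
Qed.

(** With one word per level only the spacers of a building are free, and buildings compose by
    [spaced_spaced]. Each adds at least one spacer, as [bld_rest] is nonempty. *)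
Lemma rank1_spaced (C : rank_construction 1) i N :
  exists2 ss, (N <= size ss)%N &
  gs_word C (i + N) 1 = spaced (gs_word C i 1) ss.
Proof.
elim: N => [|N [ss Nss E]]; first by exists [::]; rewrite // addn0 /spaced cats0.
have [[v0 rest calf first rest_in rest0 E1] /= e] := gs_first_built C (i + N).
have size1 : gs_size C (i + N) = 1%N by have := gs_size_bounds C (i + N); lia.
have E2 : gs_word C (i + N).+1 1 =
    spaced (gs_word C (i + N) 1) [seq p.1 | p <- rest].
  rewrite E1 e /spaced -map_comp; congr (_ ++ flatten _).
  apply/eq_in_map => p /(allP rest_in).
  by rewrite /word_level size1 /= inE => /eqP ->.
have [ss' h E'] := spaced_spaced (gs_word C i 1) ss [seq p.1 | p <- rest].
exists ss'; last by rewrite addnS E2 E E'.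
apply: leq_trans h; rewrite size_map.
by case: (rest) rest0 => //= a l _; lia.
Qed.

Lemma rank1_size (C : rank_construction 1) i : (i < size (gs_word C i 1))%N.
Proof.
have [ss iss E] := rank1_spaced C 0 i; rewrite add0n in E; rewrite E.
have w0 : gs_word C 0 1 = [:: false].
  by apply: gs_word0; have := gs_size_bounds C 0; lia.
rewrite /spaced size_cat w0 /=.
suff : (size ss <=
    size (flatten [seq nseq s true ++ [:: false] | s <- ss]))%N by lia.
by elim: ss {iss E} => //= s ss IH; rewrite !size_cat /=; lia.
Qed.

Lemma rank1_periodic (X : set biseq) (q : nat) (x : biseq) (n : int) :
  (1 < q)%N -> (forall m n, x m -> x n -> (q %| m - n)%Z) -> x n -> X x ->
  has_rank_construction 1 X ->
  exists2 per, (0 < per)%N & forall n, x (n + per%:Z) = x n.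
Proof.
move=> q1 ones xn Xx [V [[C CV] EX]]; rewrite EX in Xx.
have [p Vp] : exists p, V p.
  have [p hp] := Xx n 1%N; exists p.
  by have := congr1 (nth false ^~ 0%N) hp; rewrite /= addr0 addn0 xn => <-.
(* Level [p] suffices: its word is a prefix of [V] longer than [p], so it contains the 1 found at
   [p]. *)
have sp := rank1_size C p.
apply: (@spaced_periodic q x V (gs_word C p 1) p) => //.
  by rewrite CV nth_mkseq.
move=> N; have [ss Nss E] := rank1_spaced C p N; exists ss => //.
by rewrite -E CV size_mkseq.
Qed.

(** * Compact spaces separated by locally constant labels *)

Lemma compact_set_type (X : topologicalType) (A : set X) :
  compact A -> compact [set: A].
Proof.
move=> cA F FF _.
have [|p [Ap clp]] := cA (set_val @ F) _.
  by apply: (@filterS _ F _ setT) filterT => x _; exact: set_valP.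
exists (exist _ p (mem_set Ap)); split=> // B C FB.
rewrite nbhsE => -[U [[W oW <-] Wp] UC].
have [||_ [[b Bb <-] Wb]] := clp (set_val @` B) W.
- by apply: (@filterS _ F _ B) FB => b Bb; exists b.
- exact: open_nbhs_nbhs.
by exists b; split=> //; exact: UC.
Qed.

Lemma compact_seq_cluster (T : topologicalType) (u : nat -> T) :
  compact [set: T] -> exists p : T,
    forall A N, nbhs p A -> exists2 n, (N <= n)%N & A (u n).
Proof.
move=> /(_ (u @ \oo) _ filterT)[p [_ clp]]; exists p => A N nA.
have [|_ [[n Nn <-] An]] := clp (u @` [set n | (N <= n)%N]) A _ nA.
  by exists N => // n Nn; exists n.
by exists n.
Qed.

Section Labels.
Variables (T : topologicalType) (D : eqType) (c : nat -> T -> D).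
Hypothesis T_compact : compact [set: T].
Hypothesis c_nbhs : forall i x, nbhs x [set y | c i y = c i x].
Hypothesis c_sep : forall x y, (forall i, c i x = c i y) -> x = y.

Definition agree (j : nat) (x y : T) : Prop :=
  forall i, (i < j)%N -> c i x = c i y.

Lemma agree_leq i j x y : (i <= j)%N -> agree j x y -> agree i x y.
Proof. by move=> ij h k ki; apply: h; exact: leq_trans ij. Qed.

Lemma agree_nbhs j x : nbhs x (agree j x).
Proof.
elim: j => [|j IH]; first by apply: filterS filterT.
apply: filterS2 IH (c_nbhs j x) => y h hj i; rewrite ltnS leq_eqVlt.
by case/orP => [/eqP ->|/h].
Qed.

(* Otherwise points outside [A] agreeing with [x] further and further cluster
   at a point with all the labels of [x]. *)
Lemma nbhs_agree x (A : set T) : nbhs x A <-> exists j, agree j x `<=` A.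
Proof.
split=> [nA|[j jA]]; last by apply: filterS jA _; exact: agree_nbhs.
apply/not_existsP => no.
have /choice[u uP] j : exists y, agree j x y /\ ~ A y.
  have /existsNP[y /not_implyP h] : ~ agree j x `<=` A by exact: no.
  by exists y.
have [p hp] := compact_seq_cluster u T_compact.
have xp : x = p.
  apply: c_sep => i; have [n ni <-] := hp _ i.+1 (c_nbhs i p).
  by apply: (uP n).1.
by rewrite xp in nA; have [n _ An] := hp _ 0%N nA; exact: (uP n).2.
Qed.

Variable R : realType.

(** An ultrametric governed by the first label that differs. It serves both the subshift, labelled
    by letters, and the odometer, labelled by residues. *)
Definition label_dist (x y : T) : R :=
  if pselect (exists i, c i x != c i y) is left ex
  then (ex_minn ex).+1%:R^-1 else 0.

Lemma label_dist_le x y j : label_dist x y <= j.+1%:R^-1 <-> agree j x y.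
Proof.
rewrite /label_dist; case: pselect => [ex|nex].
  case: ex_minnP => k ck kmin.
  rewrite lef_pV2 ?posrE ?ltr0n // ler_nat ltnS; split=> [jk i ij|h].
    by apply: contraTeq (leq_trans ij jk) => /kmin; rewrite -leqNgt.
  by rewrite leqNgt; apply/negP => /h /eqP; rewrite (negPf ck).
rewrite invr_ge0 ler0n; split=> // _ i _.
by have [//|ne] := eqVneq (c i x) (c i y); case: nex; exists i.
Qed.

Lemma label_dist_cases x y :
  (x = y /\ label_dist x y = 0) \/ exists k, label_dist x y = k.+1%:R^-1.
Proof.
rewrite /label_dist; case: pselect => [ex|nex]; last first.
  left; split=> //; apply: c_sep => i.
  by have [//|ne] := eqVneq (c i x) (c i y); case: nex; exists i.
by right; exists (ex_minn ex).
Qed.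

Lemma label_dist_lt e : 0 < e -> exists j, forall x y,
  agree j x y -> label_dist x y < e.
Proof.
move=> e0; pose j := Num.truncn e^-1; exists j => x y /label_dist_le h.
apply: le_lt_trans h _; rewrite invf_plt ?posrE ?ltr0n //.
by apply: truncnS_gt.
Qed.

Lemma label_dist_lt_agree x y k : label_dist x y < k.+1%:R^-1 -> agree k.+1 x y.
Proof.
case: (label_dist_cases x y) => [[-> _ //]|[l el]].
rewrite el ltf_pV2 ?posrE ?ltr0n // ltr_nat ltnS => kl.
by apply: (agree_leq kl); apply/label_dist_le; rewrite el.
Qed.

Lemma label_dist_compatible : compatible_metric label_dist.
Proof.
have refl x : label_dist x x = 0.
  rewrite /label_dist; case: pselect => // ex.
  by exfalso; case: ex => i; rewrite eqxx.
have ge0 x y : 0 <= label_dist x y.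
  by case: (label_dist_cases x y) => [[_ ->]|[k ->]]; rewrite // invr_ge0.
split.
- move=> x y; split=> [|->//].
  case: (label_dist_cases x y) => [[-> //]|[k ->]] /eqP.
  by rewrite invr_eq0 pnatr_eq0.
- have le a b : label_dist a b <= label_dist b a.
    case: (label_dist_cases b a) => [[-> _]|[k ek]]; first by rewrite refl.
    rewrite ek; apply/label_dist_le => i ik; apply/esym; move: i ik.
    by apply/label_dist_le; rewrite ek.
  by move=> x y; apply/le_anti; rewrite !le.
- move=> x y z; case: (label_dist_cases x z) => [[_ ->]|[k ek]].
    exact: addr_ge0.
  (* If both distances on the right were below [k.+1%:R^-1], then [x] and [z] would agree on label
     [k] too. *)
  have [le|lt] := leP k.+1%:R^-1 (label_dist x y).
    by rewrite ek (le_trans le) // lerDl.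
  have [le|lt'] := leP k.+1%:R^-1 (label_dist y z).
    by rewrite ek (le_trans le) // lerDr.
  have : agree k.+1 x z.
    by move=> i ik; rewrite (label_dist_lt_agree lt ik) (label_dist_lt_agree lt').
  by move/label_dist_le; rewrite ek lef_pV2 ?posrE ?ltr0n // ler_nat ltnn.
- move=> x A; rewrite nbhs_agree; split=> [[j jA]|[e e0 eA]].
    exists j.+1%:R^-1; first by rewrite invr_gt0 ltr0n.
    by move=> y /ltW /label_dist_le; exact: jA.
  have [j hj] := label_dist_lt e0; exists j => y /hj; exact: eA.
Qed.

Lemma label_dynamical_system (S : homeo T T) : dynamical_system R S.
Proof. by split=> //; exists label_dist; exact: label_dist_compatible. Qed.

(** Such an [S] is an isometry of [label_dist]; the equivalence transfers to [hinv S], which covers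
    the negative iterates. *)
Lemma label_equicontinuous (S : homeo T T) :
  (forall i x y, c i (S x) = c i (S y) <-> c i x = c i y) ->
  equicontinuous_system R S.
Proof.
move=> cS; split; first exact: label_dynamical_system.
exists label_dist; first exact: label_dist_compatible.
have cSn n : forall i x y,
    c i (iterz S n x) = c i (iterz S n y) <-> c i x = c i y.
  case: n => n i x y; rewrite /iterz.
    by elim: n => [//|n IH] /=; rewrite cS.
  by elim: n.+1 => [//|k IH] /=; rewrite -cS !hinvK.
move=> e e0; have [j hj] := label_dist_lt e0.
exists j.+1%:R^-1; first by rewrite invr_gt0 ltr0n.
move=> x y /ltW /label_dist_le xy n; apply: hj => i ij.
by apply/cSn; exact: xy.
Qed.
End Labels.

Lemma nbhs_coord (x : biseq) (n : int) : nbhs x [set y : biseq | y n = x n].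
Proof.
apply: (@proj_continuous int (fun=> bool) n x [set b | b = x n]).
by rewrite nbhs_principalE; apply/principal_filterP.
Qed.

Lemma nbhs_window (x : biseq) (m : int) (len : nat) :
  nbhs x [set y : biseq | bi_subword_at y m len = bi_subword_at x m len].
Proof.
elim: len => [|len IH]; first by apply: filterS filterT.
apply: filterS2 IH (nbhs_coord x (m + len%:Z)) => y /= h hy.
by rewrite /bi_subword_at !mkseqS -!/(bi_subword_at _ m len) h hy.
Qed.

Lemma X_of_closed (V : nat -> bool) : closed (X_of V).
Proof.
move=> x clx m len; have [y [Xy yx]] := clx _ (nbhs_window x m len).
have [m' e] := Xy m len; exists m'; rewrite -e; exact: esym yx.
Qed.

Lemma X_of_subshift (V : nat -> bool) : subshift (X_of V).
Proof.
split; first exact: X_of_closed.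
apply/seteqP; split=> [_ [x Xx <-] m len|x Xx].
  have [m' e] := Xx (m + 1) len; exists m'; rewrite -e.
  by apply: eq_mkseq => k; rewrite /= /shift_fun addrAC.
exists (shift_inv x); last exact: shift_invK.
move=> m len; have [m' e] := Xx (m - 1) len; exists m'; rewrite -e.
by apply: eq_mkseq => k; rewrite /shift_inv addrAC.
Qed.

Lemma biseq_compact : compact [set: biseq].
Proof.
have := @tychonoff _ (fun _ : int => _) _ (fun=> bool_compact).
by congr (compact _); rewrite eqEsubset.
Qed.

Lemma X_of_compact (V : nat -> bool) : compact [set: X_of V].
Proof.
apply: compact_set_type; apply: subclosed_compact biseq_compact _ => //.
exact: X_of_closed.
Qed.

(** Pairing coordinates [i] and [-i] indexes the labels by natural numbers, so agreement up to [j]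
    is agreement on a central window. *)
Definition coord_label (i : nat) (x : biseq) : bool * bool :=
  (x i%:Z, x (- i%:Z)).

Lemma coord_label_nbhs i x : nbhs x [set y | coord_label i y = coord_label i x].
Proof.
apply: filterS2 (nbhs_coord x i%:Z) (nbhs_coord x (- i%:Z)) => y /= h h'.
by congr pair; [exact: h|exact: h'].
Qed.

Lemma coord_label_sep x y :
  (forall i, coord_label i x = coord_label i y) -> x = y.
Proof.
move=> h; apply/funext => -[n|n]; first by case: (h n).
by rewrite NegzE; case: (h n.+1).
Qed.

Lemma coord_label_sub_nbhs (X : set biseq) i (x : X) :
  nbhs x [set y : X | coord_label i (\val y) = coord_label i (\val x)].
Proof.
exact: (@initial_continuous X biseq set_val x _ (coord_label_nbhs i _)).
Qed.

Lemma coord_label_sub_sep (X : set biseq) (x y : X) :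
  (forall i, coord_label i (\val x) = coord_label i (\val y)) -> x = y.
Proof. by move=> /coord_label_sep /val_inj. Qed.

Lemma iterz_shift (n : int) (x : biseq) :
  iterz shift n x = (fun k => x (k + n)).
Proof.
case: n => n /=.
  elim: n => [|n IH]; first by apply/funext => k; rewrite addr0.
  by rewrite iterS IH; apply/funext => k; rewrite /= /shift_fun; congr (x _); lia.
rewrite -iterS NegzE; elim: n.+1 => [|k IH].
  by apply/funext => k; rewrite oppr0 addr0.
by rewrite iterS IH; apply/funext => l; rewrite /= /shift_inv; congr (x _); lia.
Qed.

(** * The Toeplitz subshift of a sequence of periods *)

Lemma mkseq_flatten (T : Type) (f : nat -> T) (q p : nat) :
  mkseq f (q * p) =
    flatten (mkseq (fun t => mkseq (fun k => f (t * p + k)%N) p) q).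
Proof.
elim: q => [|q IH]; first by rewrite mul0n.
rewrite mulSnr /mkseq iotaD map_cat -/(mkseq f _) IH.
rewrite -[q.+1]addn1 iotaD map_cat flatten_cat /= cats0; congr (_ ++ _).
by rewrite add0n -[X in iota X _]addn0 iotaDl -map_comp.
Qed.

Section Odometer.
Variable P : nat -> nat.
Hypothesis P0 : P 0 = 1%N.
Hypothesis P_dvd : forall i, (P i %| P i.+1)%N.
Hypothesis P_ge3 : forall i, (3 * P i <= P i.+1)%N.

Lemma P_gt0 i : (0 < P i)%N.
Proof. by elim: i => [|i IH]; [rewrite P0|have := P_ge3 i; lia]. Qed.

Lemma ltn_P i : (i < P i)%N.
Proof. by elim: i => [|i IH]; [rewrite P0|have := P_ge3 i; lia]. Qed.

Lemma P_dvd_leq i j : (i <= j)%N -> (P i %| P j)%N.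
Proof.
move/subnK <-; elim: (j - i)%N => [//|k IH].
by rewrite addSn; exact: dvdn_trans IH (P_dvd _).
Qed.

Lemma P_leq i j : (i <= j)%N -> (P i <= P j)%N.
Proof. by move=> ij; apply: dvdn_leq (P_gt0 j) (P_dvd_leq ij). Qed.

(** Of the class of [hole i] modulo [P i], the second class modulo [P i.+1] is kept as the next hole
    class. Not keeping the first one pushes the holes to infinity, so every natural place gets
    filled. *)
Definition hole (i : nat) : nat := \sum_(k < i) P k.

Lemma hole0 : hole 0 = 0%N. Proof. by rewrite /hole big_ord0. Qed.

Lemma holeS i : hole i.+1 = (hole i + P i)%N.
Proof. by rewrite /hole big_ord_recr. Qed.

Lemma hole_lt i : (hole i < P i)%N.
Proof.
elim: i => [|i IH]; first by rewrite hole0 P0.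
by rewrite holeS; have := P_ge3 i; have := P_gt0 i; lia.
Qed.

Lemma leq_hole i : (i <= hole i)%N.
Proof. by elim: i => [//|i IH]; rewrite holeS; have := P_gt0 i; lia. Qed.

(** The place [z] is not filled by the levels below [i]; its level is exactly [i] when moreover
    [hit i.+1 z] fails. *)
Definition hit (i : nat) (z : int) : bool := (P i %| z - (hole i)%:Z)%Z.

Lemma hit0 z : hit 0 z.
Proof. by rewrite /hit P0 dvd1z. Qed.

Lemma hit_leq i j z : (i <= j)%N -> hit j z -> hit i z.
Proof.
move/subnK <-; elim: (j - i)%N => [//|k IH]; rewrite addSn => h; apply: IH.
move: h; rewrite /hit holeS PoszD opprD addrA => h.
rewrite -[z - _](subrK (P (k + i)%N)%:Z) rpredDr ?dvdzz //.
by apply: dvdz_trans h; rewrite dvdzE /= P_dvd.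
Qed.

Lemma hit_congr i (z w : int) : (P i %| z - w)%Z -> hit i z = hit i w.
Proof.
by move=> h; rewrite /hit -[z in LHS](subrK w) -addrA rpredDl.
Qed.

Lemma hit_sub i (z w : int) : hit i z -> hit i w -> (P i %| z - w)%Z.
Proof.
move=> hz hw; have -> : z - w = (z - (hole i)%:Z) - (w - (hole i)%:Z) by lia.
exact: rpredB.
Qed.

Lemma hit_nat_lt i (n : nat) : (n < hole i)%N -> ~~ hit i n%:Z.
Proof.
move=> ni; apply/negP; rewrite /hit dvdzE /=.
have := hole_lt i; move=> hl /dvdn_leq; lia.
Qed.

Lemma hit_nat_eq i (n : nat) : (n < P i)%N -> hit i n%:Z = (n == hole i).
Proof.
move=> ni; apply/idP/eqP => [|->]; last by rewrite /hit subrr dvdz0.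
rewrite /hit dvdzE /= => h; have := hole_lt i => hl.
have [//|ne] := eqVneq n (hole i).
by move: h => /dvdn_leq; lia.
Qed.

Lemma hit_level J z : ~~ hit J z ->
  exists i, [/\ (i < J)%N, hit i z & ~~ hit i.+1 z].
Proof.
elim: J => [|J IH] h; first by rewrite hit0 in h.
case: (boolP (hit J z)) => hJ; first by exists J.
by have [i [iJ ? ?]] := IH hJ; exists i; split => //; exact: ltnW.
Qed.

(* Thus letter [n] is the parity of the largest [i] with [hit i n]. *)
Definition toeplitz (n : nat) : bool :=
  `[< exists i, [/\ odd i, hit i n%:Z & ~~ hit i.+1 n%:Z] >].

Lemma level_uniq i j z :
  hit i z -> ~~ hit i.+1 z -> hit j z -> ~~ hit j.+1 z -> i = j.
Proof.
move=> hi nhi hj nhj; have [ij|ij|//] := ltngtP i j.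
  by rewrite (hit_leq ij hj) in nhi.
by rewrite (hit_leq ij hi) in nhj.
Qed.

Lemma toeplitzE i (n : nat) :
  hit i n%:Z -> ~~ hit i.+1 n%:Z -> toeplitz n = odd i.
Proof.
move=> hi nhi; apply/asboolP/idP => [[j [oj hj nhj]]|oi]; last by exists i.
by rewrite (level_uniq hi nhi hj nhj).
Qed.

(** * Phases: elements of the inverse limit of the groups Z/P_i *)

Definition coherent (a : nat -> int) : Prop :=
  forall i, (P i %| a i.+1 - a i)%Z.

(** Place [n] of [x] plays the role of place [a + n] of the Toeplitz word. A place that is a hole at
    every level is left unconstrained. *)
Definition has_phase (x : int -> bool) (a : nat -> int) : Prop :=
  forall i n, hit i (a i + n) -> ~~ hit i.+1 (a i.+1 + n) -> x n = odd i.

Lemma coherent_dvdz a i j : coherent a -> (i <= j)%N -> (P i %| a j - a i)%Z.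
Proof.
move=> ca /subnK <-; elim: (j - i)%N => [|k IH]; first by rewrite subrr dvdz0.
rewrite addSn -[a _](subrK (a (k + i)%N)) -addrA rpredD //.
by apply: dvdz_trans (ca _); rewrite dvdzE /= P_dvd_leq // leq_addl.
Qed.

Lemma hit_coherent a i j n : coherent a -> (i <= j)%N ->
  hit i (a j + n) = hit i (a i + n).
Proof.
move=> ca ij; apply: hit_congr.
by rewrite opprD addrACA subrr addr0; exact: coherent_dvdz.
Qed.

Lemma phase_level a J n : coherent a -> ~~ hit J (a J + n) ->
  exists i, [/\ (i < J)%N, hit i (a i + n) & ~~ hit i.+1 (a i.+1 + n)].
Proof.
move=> ca h; have [i [iJ h1 h2]] := hit_level h; exists i.
by split => //; [rewrite -(hit_coherent _ ca (ltnW iJ))|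
  rewrite -(hit_coherent _ ca iJ)].
Qed.

Lemma residue_ex (i : nat) (b : int) (t : nat) : (t < P i)%N ->
  exists2 n : nat, (n < P i)%N & (P i %| b + n%:Z - t%:Z)%Z.
Proof.
move=> tP; have P0i : 0 < (P i)%:Z by have := P_gt0 i; lia.
have Pn0 : (P i)%:Z != 0 by rewrite gt_eqF.
have := eqz_mod_dvd (P i)%:Z (modz (t%:Z - b) (P i)%:Z) (t%:Z - b).
have := ltz_pmod (t%:Z - b) P0i; have := modz_ge0 (t%:Z - b) Pn0.
rewrite modz_mod eqxx; move: (modz _ _) => [r|//] _ rP h; exists r => //.
by have -> : b + r%:Z - t%:Z = r%:Z - (t%:Z - b) by lia.
Qed.

(** A place of phase [hole j] modulo [P j.+1] has level exactly [j], because the next hole is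
    [hole j + P j], another class modulo [P j.+1]. *)
Lemma level_place j a : coherent a -> exists n : nat,
  [/\ (n < P j.+1)%N, hit j (a j + n%:Z) & ~~ hit j.+1 (a j.+1 + n%:Z)].
Proof.
move=> ca; have hlt := leq_trans (hole_lt j) (P_leq (leqnSn j)).
have [n nP hn] := @residue_ex j.+1 (a j.+1) _ hlt; exists n; split => //.
  rewrite -(hit_coherent _ ca (leqnSn _)) (hit_congr (w := (hole j)%:Z)).
    by rewrite hit_nat_eq ?hole_lt.
  by apply: dvdz_trans hn; rewrite dvdzE /= P_dvd.
rewrite (hit_congr hn) hit_nat_eq // (holeS j).
by have := P_gt0 j; lia.
Qed.

(* A place of level exactly [j.+1] within one period of [P j.+2] tells apart two
   phases that first differ modulo [P j.+1]: the other phase sees level [j]. *)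
Lemma phase_local_uniq j x x' a a' : coherent a -> coherent a' ->
  has_phase x a -> has_phase x' a' ->
  (forall n : nat, (n < P j.+1)%N -> x n%:Z = x' n%:Z) ->
  (P j %| a j - a' j)%Z.
Proof.
move=> ca ca' xa xa'; elim: j => [|j IH] agree; first by rewrite P0 dvd1z.
have {}IH : (P j %| a j - a' j)%Z.
  by apply: IH => n nj; apply: agree; apply: leq_trans nj (P_leq _).
have [n [nP hj1 hj2]] := level_place j.+1 ca.
have xn := xa _ _ hj1 hj2; apply: contraT => ne.
have nj1 : ~~ hit j.+1 (a' j.+1 + n).
  apply: contra ne => /(hit_sub hj1).
  by rewrite opprD addrACA subrr addr0.
have hj : hit j (a' j + n).
  rewrite -(hit_congr (z := a j + n)); last by rewrite opprD addrACA subrr addr0.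
  by rewrite -(hit_coherent _ ca (leqnSn _)); exact: hit_leq (leqnSn _) hj1.
have := xa' _ _ hj nj1; rewrite -agree // xn /=; by case: (odd j).
Qed.

(** Places of disagreement are holes at every level, hence congruent modulo every [P i]. Taking for
    [i] their distance forces it to be 0, since [i < P i]. *)
Lemma phase_disagree x x' a m n : coherent a -> has_phase x a ->
  has_phase x' a ->
  x m != x' m -> x n != x' n -> m = n.
Proof.
move=> ca xa xa' hm hn.
have allhit k : x k != x' k -> forall i, hit i (a i + k).
  move=> ne i; apply: contraT => /(phase_level ca)[l [_ h1 h2]].
  by rewrite (xa _ _ h1 h2) (xa' _ _ h1 h2) eqxx in ne.
pose i := `|m - n|%N.
have := hit_sub (allhit _ hm i) (allhit _ hn i).
rewrite opprD addrACA subrr add0r dvdzE /= -/i => h.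
have := ltn_P i; have : (i == 0)%N || (P i <= i)%N.
  by case: posnP => //= i0; exact: dvdn_leq.
rewrite {1}/i; lia.
Qed.

(* The sequence read off a phase; at the place, if any, which is a hole of every
   level it takes the value [false]. *)
Definition sequence_of (a : nat -> int) (n : int) : bool :=
  `[< exists i, [/\ odd i, hit i (a i + n) & ~~ hit i.+1 (a i.+1 + n)] >].

Lemma phase_sequence_of a : coherent a -> has_phase (sequence_of a) a.
Proof.
move=> ca i n hi nhi; apply/asboolP/idP => [[j [oj hj nhj]]|oi]; last by exists i.
have [ij|ij|-> //] := ltngtP i j.
  case/negP: nhi; rewrite -(hit_coherent _ ca ij); exact: hit_leq hj.
case/negP: nhj; rewrite -(hit_coherent _ ca ij); exact: hit_leq hi.
Qed.

(** A window is copied into [toeplitz] at a place congruent to it modulo a large [P J]. A place that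
    is never filled carries [false]; its copy is arranged to have level exactly [J], with [J]
    even. *)
Lemma sequence_of_in_X a : coherent a -> X_of toeplitz (sequence_of a : biseq).
Proof.
move=> ca m len.
have /choice[g gP] k : exists j, forall i,
    ~~ hit i (a i + (m + k%:Z)) -> ~~ hit j (a j + (m + k%:Z)).
  have [[i hi]|no] := pselect (exists i, ~~ hit i (a i + (m + k%:Z))).
    by exists i.
  by exists 0%N => i hi; case: no; exists i.
pose J := (2 * (len + \max_(k < len) g k))%N.
have Jeven : odd J = false by rewrite /J oddM.
have lenP : (len < P J)%N by apply: leq_ltn_trans (ltn_P _); rewrite /J; lia.
have allhit k : (k < len)%N -> hit J (a J + (m + k%:Z)) ->
    forall i, hit i (a i + (m + k%:Z)).
  move=> kl hJ i; apply: contraT => /gP; rewrite -(hit_coherent _ ca (j := J)).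
    move/negP; case; apply: hit_leq hJ.
    have := @leq_bigmax _ (fun k : 'I_len => g k) (Ordinal kl); rewrite /J /=; lia.
  have := @leq_bigmax _ (fun k : 'I_len => g k) (Ordinal kl); rewrite /J /=; lia.
have P0J := P_gt0 J; have P3J := P_ge3 J.
have [r rP hr] := @residue_ex J (- (a J + m)) 0 P0J.
(* Adding [2 * P J] puts the copy past [hole J.+1], but by less than [P J.+1], so none of its places
   is hit at level [J.+1]. *)
pose M := (r + 2 * P J)%N.
have hM k : (P J %| a J + (m + k%:Z) - (M + k)%N%:Z)%Z.
  have -> : a J + (m + k%:Z) - (M + k)%N%:Z =
    - ((- (a J + m) + r%:Z - 0%:Z) + 2%:Z * (P J)%:Z) by rewrite /M; lia.
  by rewrite rpredN rpredD // dvdz_mull // dvdzz.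
exists M; apply: (@eq_from_nth _ false); first by rewrite !size_mkseq.
rewrite size_mkseq => k kl; rewrite !nth_mkseq //.
case: (boolP (hit J (a J + (m + k%:Z)))) => hJ.
  have -> : sequence_of a (m + k%:Z) = false.
    by apply/asboolP => -[i [_ _]]; rewrite (allhit _ kl hJ).
  rewrite (@toeplitzE J) -?(hit_congr (hM k)) //.
  apply/negP; rewrite /hit holeS dvdzE /= => /dvdn_leq.
  by have := hole_lt J; rewrite /M; lia.
have [i [iJ h1 h2]] := phase_level ca hJ.
rewrite (phase_sequence_of ca h1 h2); apply/esym/toeplitzE.
  rewrite -(hit_congr (z := a J + (m + k%:Z))) ?(hit_coherent _ ca (ltnW iJ)) //.
  by apply: dvdz_trans (hM k); rewrite dvdzE /= P_dvd_leq // ltnW.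
rewrite -(hit_congr (z := a J + (m + k%:Z))) ?(hit_coherent _ ca iJ) //.
by apply: dvdz_trans (hM k); rewrite dvdzE /= P_dvd_leq.
Qed.

(** By [leq_hole], the levels below [J = m + len] fill all places of [toeplitz] below [J]. The word
    therefore recurs wherever [x] has phase [m] modulo [P J]. *)
Lemma phase_recurrent x a : coherent a -> has_phase x a -> forall m len,
  exists n : int, bi_subword_at (x : biseq) n len = subword_at toeplitz m len.
Proof.
move=> ca xa m len; pose J := (m + len)%N.
have mP : (m < P J)%N by apply: leq_ltn_trans (ltn_P _); rewrite leq_addr.
have [n _ hn] := @residue_ex J (a J) _ mP.
exists n%:Z; apply: (@eq_from_nth _ false); first by rewrite !size_mkseq.
rewrite size_mkseq => k kl; rewrite !nth_mkseq //.
have nhJ : ~~ hit J (m + k)%N.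
  by apply: hit_nat_lt; apply: leq_trans (leq_hole _); rewrite ltn_add2l.
have [i [iJ h1 h2]] := hit_level nhJ; rewrite (toeplitzE h1 h2).
have hk : (P J %| a J + (n%:Z + k%:Z) - (m + k)%N%:Z)%Z.
  by have -> : a J + (n%:Z + k%:Z) - (m + k)%N%:Z = a J + n%:Z - m%:Z by lia.
have e l : (l <= J)%N -> hit l (a l + (n%:Z + k%:Z)) = hit l (m + k)%N%:Z.
  move=> lJ; rewrite -(hit_coherent _ ca lJ); apply: hit_congr.
  by apply: dvdz_trans hk; rewrite dvdzE /= P_dvd_leq.
by apply: xa; rewrite e // ltnW.
Qed.
Lemma phase_shift x a (p : int) :
  has_phase x a -> has_phase (fun n => x (n + p)) (fun i => a i + p).
Proof.
by move=> xa i n; rewrite -!(addrA _ p n) (addrC p n); exact: xa.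
Qed.

Lemma coherent_shift a p : coherent a -> coherent (fun i => a i + p).
Proof. by move=> ca i; rewrite opprD addrACA subrr addr0. Qed.

(** A period [p] makes [a] and its translate by [p] phases of the same sequence, so [P p] divides
    [p]; as [p < P p], this forces [p = 0]. *)
Lemma phase_aperiodic x a (p : nat) : coherent a -> has_phase x a ->
  (forall n, x (n + p%:Z) = x n) -> p = 0%N.
Proof.
move=> ca xa per.
have := phase_local_uniq (coherent_shift p%:Z ca) ca
  (phase_shift (p := p%:Z) xa) xa (j := p) (fun n _ => per n%:Z).
rewrite addrAC subrr add0r dvdzE /= => h.
by have := ltn_P p; case: (posnP p) => // p0; have := dvdn_leq p0 h; lia.
Qed.

(** Level 0 writes only 0s, so all 1s lie in the hole class modulo [P 1]. *)
Lemma phase_ones x a m n : has_phase x a -> x m -> x n -> (P 1 %| m - n)%Z.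
Proof.
move=> xa xm xn.
have ones k : x k -> hit 1 (a 1 + k).
  by move=> xk; apply: contraTT xk => /(xa 0 _ (hit0 _)) ->.
by have := hit_sub (ones _ xm) (ones _ xn); rewrite opprD addrACA subrr add0r.
Qed.

(** The centre [M] of an occurrence of the window in [toeplitz] acts on it as a phase that is
    constant in [i]. *)
Lemma X_of_window x N : X_of toeplitz x -> exists M : nat, forall i n,
  (`|n| <= N)%N -> hit i (M%:Z + n) -> ~~ hit i.+1 (M%:Z + n) -> x n = odd i.
Proof.
move=> Xx; have [m hm] := Xx (- N%:Z) (2 * N).+1; exists (m + N)%N => i n nN.
pose k := `|(n + N%:Z)%R|%N; have kN : (k < (2 * N).+1)%N by rewrite /k; lia.
have -> : (m + N)%N%:Z + n = (m + k)%N%:Z by rewrite /k; lia.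
move=> h1 h2; rewrite -(toeplitzE h1 h2).
have := congr1 (nth false ^~ k) hm; rewrite !nth_mkseq // => <-.
by congr (x _); rewrite /k; lia.
Qed.

Lemma toeplitz_congr i (m n : nat) : (P i %| m%:Z - n%:Z)%Z -> ~~ hit i m%:Z ->
  toeplitz m = toeplitz n.
Proof.
move=> mn him; have [k [ki hk nhk]] := hit_level him.
have e l : (l <= i)%N -> hit l m = hit l n.
  move=> li; apply: hit_congr; apply: dvdz_trans mn.
  by rewrite dvdzE /= P_dvd_leq.
by rewrite (toeplitzE hk nhk) (@toeplitzE k) -?e // ltnW.
Qed.

(** * Blocks of length P_i and the rank-two construction *)

Definition block (i : nat) (b : bool) : word :=
  mkseq (fun k => if k == hole i then b else toeplitz k) (P i).

Definition ratio (i : nat) : nat := (P i.+1 %/ P i)%N.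

Lemma ratioE i : P i.+1 = (ratio i * P i)%N.
Proof. by rewrite /ratio divnK. Qed.

Lemma ratio_ge3 i : (3 <= ratio i)%N.
Proof. by have := P_ge3 i; rewrite ratioE leq_pmul2r ?P_gt0. Qed.

Lemma block0 b : block 0 b = [:: b].
Proof. by rewrite /block P0 /mkseq /= hole0. Qed.

Lemma toeplitz_hole i : toeplitz (hole i) = odd i.
Proof.
apply: toeplitzE; first by rewrite hit_nat_eq // hole_lt.
by apply: hit_nat_lt; rewrite holeS -[X in (X < _)%N]addn0 ltn_add2l P_gt0.
Qed.

Lemma block_toeplitz i : block i (odd i) = subword_at toeplitz 0 (P i).
Proof.
by apply: eq_mkseq => k; case: eqP => [->|]; rewrite ?add0n ?toeplitz_hole.
Qed.

(** Outside its holes [toeplitz] repeats with period [P i]. Of the holes in the [ratio i] copies,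
    the one in copy 1 is [hole i.+1] and stays free; level [i] fills the others with [odd i]. *)
Lemma blockS i b : block i.+1 b =
  flatten (mkseq (fun t => block i (if t == 1 then b else odd i)) (ratio i)).
Proof.
rewrite {1}/block ratioE mkseq_flatten; congr flatten.
apply: (@eq_from_nth _ [::]); first by rewrite !size_mkseq.
rewrite size_mkseq => t tq; rewrite !nth_mkseq //.
apply: (@eq_from_nth _ false); first by rewrite !size_mkseq.
rewrite size_mkseq => k kP; rewrite !nth_mkseq // holeS.
have P0i := P_gt0 i.
have [->|nk] := eqVneq k (hole i).
  rewrite addnC eqn_add2l -{2}[P i]mul1n eqn_pmul2r //.
  case: eqP => // /eqP t1; apply: toeplitzE.
    rewrite -(hit_congr (z := (hole i)%:Z)) ?hit_nat_eq ?hole_lt //.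
    have -> : (hole i)%:Z - (hole i + t * P i)%N%:Z = - t%:Z * (P i)%:Z by lia.
    by rewrite dvdz_mull // dvdzz.
  rewrite hit_nat_eq ?holeS ?eqn_add2l.
    by rewrite -{2}[P i]mul1n eqn_pmul2r.
  rewrite ratioE; apply: (@leq_trans (t.+1 * P i)); last by rewrite leq_pmul2r.
  by rewrite mulSn ltn_add2r hole_lt.
have hk : ~~ hit i k by rewrite hit_nat_eq.
have hd : (P i %| k%:Z - (t * P i + k)%N%:Z)%Z.
  have -> : k%:Z - (t * P i + k)%N%:Z = - t%:Z * (P i)%:Z by lia.
  by rewrite dvdz_mull // dvdzz.
rewrite -(toeplitz_congr hd hk); case: eqP => // e.
case/eqP: nk; have := congr1 (modn ^~ (P i)) e.
by rewrite modnMDl modnDr !modn_small // hole_lt.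
Qed.

Lemma hole_lt_last i : (0 < i)%N -> (hole i + 2 <= P i)%N.
Proof.
by case: i => // i _; rewrite holeS; have := hole_lt i; have := P_ge3 i; lia.
Qed.

(** The end places are not the hole of the block, and they have level 0: neither 0 nor -1 is
    congruent to [hole 1 = 1] modulo [P 1 >= 3]. *)
Lemma block_calF i b : (0 < i)%N -> calF (block i b).
Proof.
move=> i0; have P0i := P_gt0 i; have hl := hole_lt_last i0; have lh := leq_hole i.
have sP : size (block i b) = P i by rewrite size_mkseq.
have P13 : (3 <= P 1)%N by have := P_ge3 0; rewrite P0.
apply/and3P; split.
- by rewrite -size_eq0 sP -lt0n.
- have -> : head true (block i b) = nth true (block i b) 0.
    by case: (block i b).
  rewrite nth_mkseq //; case: eqP => [|_]; first by lia.
  by rewrite (@toeplitzE 0) ?hit0 // hit_nat_lt // holeS hole0 P0.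
rewrite -nth_last sP nth_mkseq ?prednK //; case: eqP => [|_]; first by lia.
rewrite (@toeplitzE 0) ?hit0 // /hit holeS hole0 P0 dvdzE /=.
apply/negP => h; have := P_dvd_leq i0.
have -> : P i = (`|((P i).-1%:Z - (0 + 1)%N%:Z)%R| + 2)%N by lia.
by rewrite dvdn_addr // => /dvdn_leq; lia.
Qed.

(** Level 0 has the single word 0: [block 0 true] is the letter 1, which only a spacer can
    supply. *)
Definition toeplitz_size (i : nat) : nat := if i == 0 then 1 else 2.

Definition toeplitz_word (i j : nat) : word := block i (odd i (+) (j != 1)).

Lemma block_in_level i b : (i = 0 -> b = false) ->
  block i b \in word_level toeplitz_size toeplitz_word i.
Proof.
rewrite /word_level /toeplitz_size /toeplitz_word.
case: eqP => [-> /(_ erefl) ->|_ _] /=; rewrite !inE ?eqxx //.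
by case: b; case: (odd i); rewrite eqxx ?orbT.
Qed.

Lemma level_calF i : all calF (word_level toeplitz_size toeplitz_word i).
Proof.
rewrite /word_level /toeplitz_size /toeplitz_word.
by case: eqP => [->|/eqP]; rewrite /= ?block0 // -lt0n => i0; rewrite !block_calF.
Qed.

Lemma block_building i b : exists B : building
  (word_level toeplitz_size toeplitz_word i) (block i.+1 b),
  bld_first B = block i (odd i).
Proof.
have q3 := ratio_ge3 i.
have cal : all calF (word_level toeplitz_size toeplitz_word i) &&
  calF (block i.+1 b) by rewrite level_calF block_calF.
have first : block i (odd i) \in word_level toeplitz_size toeplitz_word i.
  by apply: block_in_level => ->.
have [/andP[/eqP i0 b1]|nib] := boolP ((i == 0%N) && b).
  subst i.
  (* The letter 1 at place 1 becomes a spacer. The first word and the head of the list together use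
     up three letters, whence [ratio 0 - 3]. *)
  pose rest := (1%N, block 0 (odd 0)) :: nseq (ratio 0 - 3) (0%N, block 0 (odd 0)).
  have rest_in : all
      (fun p => p.2 \in word_level toeplitz_size toeplitz_word 0) rest.
    by rewrite /= first all_nseq first orbT.
  suff E : block 1 b = block 0 (odd 0) ++
      flatten [seq nseq p.1 true ++ p.2 | p <- rest].
    by exists (Building cal first rest_in isT E).
  have E m n : [seq block 0 (if t == 1 then b else odd 0) | t <- iota m.+2 n] =
      nseq n [:: false].
    by elim: n m => //= n IH m; rewrite block0 IH.
  rewrite blockS /rest -[in LHS](subnKC q3) /mkseq iotaD map_cat flatten_cat E.
  by rewrite /= map_nseq !block0 b1.
(* No spacers are needed here. Entry 0 of the list is copy 1, as copy 0 is the first word. *)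
pose rest := mkseq (fun t => (0%N, block i (if t == 0 then b else odd i))) (ratio i).-1.
have rest_in : all
    (fun p => p.2 \in word_level toeplitz_size toeplitz_word i) rest.
  apply/allP => p /mapP[t _ ->] /=; apply: block_in_level => i0.
  by move: nib; rewrite i0 /=; case: b {cal rest} => //; case: eqP.
have rest0 : rest != [::] by rewrite -size_eq0 size_mkseq; lia.
suff E : block i.+1 b = block i (odd i) ++
    flatten [seq nseq p.1 true ++ p.2 | p <- rest].
  by exists (Building cal first rest_in rest0 E).
rewrite blockS -[in LHS](@prednK (ratio i)); last by lia.
rewrite /mkseq /= -map_comp; congr (_ ++ flatten _).
by rewrite -[X in iota X _]/(1 + 0)%N iotaDl -map_comp; apply: eq_map => -[|t].
Qed.

Lemma toeplitz_rank2 : has_rank_construction 2 (X_of toeplitz).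
Proof.
exists toeplitz; split => //.
have bounds i : (1 <= toeplitz_size i <= 2)%N.
  by rewrite /toeplitz_size; case: eqP.
have word0 j : (1 <= j <= toeplitz_size 0)%N -> toeplitz_word 0 j = [:: false].
  by case: j => [|[]] //; rewrite /toeplitz_word block0.
have bld i j : exists B : building (word_level toeplitz_size toeplitz_word i)
    (toeplitz_word i.+1 j), bld_first B = toeplitz_word i 1.
  by rewrite /toeplitz_word eqxx addbF; exact: block_building.
pose G := @RankGeneratingSequence 2 toeplitz_size toeplitz_word bounds word0
  (fun i => bld i 1%N) (fun i j _ => let: ex_intro B _ := bld i j in inhabits B).
exists (@RankConstruction 2 G (fun i j _ => projT1 (cid (bld i j)))
  (fun i _ => projT2 (cid (bld i 1%N)))).
move=> i; rewrite /= /toeplitz_word eqxx addbF size_mkseq; exact: block_toeplitz.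
Qed.

Lemma phase_congr x a b : (forall i, (P i %| a i - b i)%Z) ->
  has_phase x a -> has_phase x b.
Proof.
move=> ab xa i n h1 h2; have e j : hit j (a j + n) = hit j (b j + n).
  by apply: hit_congr; rewrite opprD addrACA subrr addr0.
by apply: xa; rewrite e.
Qed.

(** * The factor map onto a system described by residues modulo all P_i *)

Variables (Y : topologicalType) (S : homeo Y Y) (r : nat -> Y -> nat).
Hypothesis Y_compact : compact [set: Y].
Hypothesis Y_inhabited : inhabited Y.
Hypothesis r_nbhs : forall i y, nbhs y [set z | r i z = r i y].
Hypothesis r_sep : forall y z, (forall i, r i y = r i z) -> y = z.
Hypothesis r_coh : forall i y, r i y = (r i.+1 y %% P i)%N.
Hypothesis r_S : forall i y, r i (S y) = ((r i y).+1 %% P i)%N.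

Lemma r_lt i y : (r i y < P i)%N.
Proof. by rewrite r_coh ltn_mod P_gt0. Qed.

Lemma r_iter i n y : r i (iter n S y) = ((r i y + n) %% P i)%N.
Proof.
elim: n => [|n IH]; first by rewrite addn0 modn_small ?r_lt.
by rewrite iterS r_S IH -addn1 modnDml addn1 addnS.
Qed.

Lemma r_surj i t : (t < P i)%N -> exists y, r i y = t.
Proof.
move=> tP; have [y] := Y_inhabited; have ry := r_lt i y.
exists (iter (P i + t - r i y) S y); rewrite r_iter.
by rewrite subnKC ?modnDl ?modn_small //; lia.
Qed.

Lemma r_S_eq i y z : r i (S y) = r i (S z) <-> r i y = r i z.
Proof.
rewrite !r_S; split=> [/eqP|-> //]; rewrite -[(r i y).+1]addn1 -[(r i z).+1]addn1.
by rewrite eqn_modDr !modn_small ?r_lt // => /eqP.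
Qed.

Definition phase (y : Y) (i : nat) : int := (r i y)%:Z.

Lemma dvdz_modn (d m : nat) : (d %| (m %% d)%N%:Z - m%:Z)%Z.
Proof. by rewrite -eqz_mod_dvd !modz_nat modn_mod. Qed.

Lemma phase_coherent y : coherent (phase y).
Proof. by move=> i; rewrite -rpredN opprB /phase r_coh dvdz_modn. Qed.

Lemma phase_eq i y z : (P i %| phase y i - phase z i)%Z -> r i y = r i z.
Proof.
rewrite -eqz_mod_dvd !modz_nat => /eqP[].
by rewrite !modn_small ?r_lt.
Qed.

Lemma phase_S x y :
  has_phase x (phase y) -> has_phase (shift_fun x) (phase (S y)).
Proof.
move=> /(phase_shift (p := 1)); apply: phase_congr => i.
by rewrite -rpredN opprB /phase r_S -addn1 -PoszD dvdz_modn.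
Qed.

(** For each [N], a point of [Y] whose residue modulo [P N] is that of an occurrence of the window
    of radius [N] has the right phase there. By local constancy of residues, a cluster point of
    these has it everywhere. *)
Lemma phase_ex x : X_of toeplitz x -> exists y, has_phase x (phase y).
Proof.
move=> Xx; have /choice[u uP] N : exists y, forall i n, (`|n| <= N)%N ->
    (i < N)%N -> hit i (phase y i + n) -> ~~ hit i.+1 (phase y i.+1 + n) ->
    x n = odd i.
  have [M hM] := @X_of_window x N Xx.
  have [y ry] := r_surj (ltn_pmod M (P_gt0 N)).
  exists y => i n nN iN.
  have e l : (l <= N)%N -> hit l (phase y l + n) = hit l (M%:Z + n).
    move=> lN; rewrite -(hit_coherent _ (phase_coherent y) lN).
    apply: hit_congr; rewrite opprD addrACA subrr addr0 /phase ry.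
    apply: dvdz_trans (dvdz_modn (P N) M).
    by rewrite dvdzE /= P_dvd_leq.
  by rewrite !e ?(ltnW iN) //; exact: hM.
have [y hy] := compact_seq_cluster u Y_compact.
exists y => i n h1 h2.
have [N le [e1 e2]] := hy _ (`|n| + i.+1)%N (filterI (r_nbhs i y) (r_nbhs i.+1 y)).
apply: (uP N) => //; rewrite ?/phase ?e1 ?e2 //; lia.
Qed.

Lemma phase_uniq x y z :
  has_phase x (phase y) -> has_phase x (phase z) -> y = z.
Proof.
move=> xy xz; apply: r_sep => i; apply: phase_eq.
exact: (@phase_local_uniq i x x _ _
  (phase_coherent y) (phase_coherent z)).
Qed.

Let X := X_of toeplitz.
Let hX : subshift X := X_of_subshift toeplitz.
Let T := subshift_map hX.

Definition odometer_factor (x : X) : Y := projT1 (cid (phase_ex (set_valP x))).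

Lemma phase_factor x : has_phase (\val x : biseq) (phase (odometer_factor x)).
Proof. exact: projT2 (cid (phase_ex (set_valP x))). Qed.

Lemma factor_uniq x y :
  has_phase (\val x : biseq) (phase y) -> odometer_factor x = y.
Proof. exact: phase_uniq (@phase_factor x). Qed.

Lemma factor_surj y : exists x, odometer_factor x = y.
Proof.
have Xy := sequence_of_in_X (phase_coherent y).
exists (exist _ (sequence_of (phase y) : biseq) (mem_set Xy)); apply: factor_uniq.
exact: phase_sequence_of (phase_coherent y).
Qed.

Lemma factor_shift x : odometer_factor (T x) = S (odometer_factor x).
Proof. by apply: factor_uniq; exact: phase_S (@phase_factor x). Qed.

(** By [phase_local_uniq], the [P j.+1] letters from place 0 on determine the residues of index
    below [j]. *)
Lemma factor_continuous : continuous odometer_factor.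
Proof.
move=> x A /(nbhs_agree Y_compact r_nbhs r_sep)[j jA].
have nx : nbhs x [set x' : X | bi_subword_at (\val x') 0 (P j.+1) =
    bi_subword_at (\val x) 0 (P j.+1)].
  exact: (@initial_continuous X biseq set_val x _ (nbhs_window (\val x) 0 _)).
apply: filterS nx => x' hx'.
apply: jA => i ij; apply: phase_eq.
apply: (@phase_local_uniq i _ _ _ _ (phase_coherent _)
  (phase_coherent _) (@phase_factor x) (@phase_factor x')) => n ni.
have nj : (n < P j.+1)%N by apply: leq_trans ni (P_leq _); exact: ltnW.
have := congr1 (nth false ^~ n) hx'.
by rewrite /bi_subword_at !nth_mkseq // !add0r.
Qed.

Lemma factor_is_factor : factor_map T S odometer_factor.
Proof.
split; [exact: factor_continuous| |exact: factor_shift].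
by apply/seteqP; split=> // y _; have [x <-] := factor_surj y; exists x.
Qed.

(** Every window of [x'] is a subword of [toeplitz], and [phase_recurrent] finds it in [x]. *)
Lemma X_of_toeplitz_minimal : minimal_subshift X.
Proof.
split=> // x Xx x' Xx' B.
move=> /(nbhs_agree biseq_compact coord_label_nbhs coord_label_sep)[j jB].
have [y xy] := phase_ex Xx.
have [m hm] := Xx' (- j%:Z) (2 * j).+1.
have [n hn] := phase_recurrent (phase_coherent y) xy m (2 * j).+1.
exists (iterz shift (n + j%:Z) x); split; first by exists (n + j%:Z).
apply: jB => i ij; rewrite iterz_shift.
have e (k : nat) : (k < (2 * j).+1)%N -> x' (- j%:Z + k%:Z) = x (n + k%:Z).
  move=> kj; have := congr1 (nth false ^~ k) (etrans hm (esym hn)).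
  by rewrite /bi_subword_at !nth_mkseq.
have e' (k : int) : (`|k| <= j)%N -> x' k = x (k + (n + j%:Z)).
  move=> kj; have := e `|(k + j%:Z)%R|%N.
  have -> : - j%:Z + `|(k + j%:Z)%R|%N%:Z = k by lia.
  have -> : n + `|(k + j%:Z)%R|%N%:Z = k + (n + j%:Z) by lia.
  by apply; lia.
by congr pair; apply: e'; lia.
Qed.

Lemma X_of_toeplitz_rank2 : symbolic_rank X 2.
Proof.
split=> //; first exact: toeplitz_rank2.
move=> m m1 rk; rewrite leqNgt; apply/negP => m2.
have {m1 m2} m1 : m = 1%N by lia.
rewrite m1 in rk; have [y0] := Y_inhabited; have [x ex] := factor_surj y0.
have xy := @phase_factor x; set a := phase _ in xy.
have ca : coherent a by exact: phase_coherent.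
(* A place of level 1 carries the letter 1, as 1 is odd; [rank1_periodic] asks for such a place. *)
have [n [_ h1 h2]] := level_place 1 ca.
have xn : (\val x : biseq) n%:Z by rewrite (xy _ _ h1 h2).
have [||per per0 hper] :=
  @rank1_periodic X (P 1) (\val x) n _ _ xn (set_valP x) rk.
- by have := P_ge3 0; rewrite P0; lia.
- by move=> k l; exact: phase_ones xy.
by have := phase_aperiodic ca xy hper; lia.
Qed.

(** * Equicontinuity and maximality of the factor *)

Variable R : realType.

Lemma X_dynamical_system : dynamical_system R T.
Proof.
exact: (@label_dynamical_system X _ (fun i x => coord_label i (\val x))
  (@X_of_compact _) (@coord_label_sub_nbhs X) (@coord_label_sub_sep X)).
Qed.

Lemma odometer_equicontinuous : equicontinuous_system R S.
Proof. exact: (label_equicontinuous Y_compact r_nbhs r_sep R r_S_eq). Qed.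

Let X_agree_nbhs := @agree_nbhs X _ (fun i x => coord_label i (\val x))
  (@coord_label_sub_nbhs X).
Let X_nbhs_agree := @nbhs_agree X _ (fun i x => coord_label i (\val x))
  (@X_of_compact _) (@coord_label_sub_nbhs X) (@coord_label_sub_sep X).

Lemma val_iter n (x : X) k :
  (\val (iter n T x) : biseq) k = (\val x : biseq) (k + n%:Z).
Proof.
elim: n k => [|n IH] k; first by rewrite addr0.
by rewrite iterS /= /shift_fun IH; congr ((\val x : biseq) _); lia.
Qed.

(* Two points with the same image are asymptotic under [T], hence their images
   in an equicontinuous factor coincide. *)
Lemma factor_fiber (Z : topologicalType) (G : homeo Z Z) (psi : X -> Z) :
  equicontinuous_system R G -> factor_map T G psi ->
  forall x x', odometer_factor x = odometer_factor x' -> psi x = psi x'.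
Proof.
move=> [_ [rho [rho0 rhoC rhoD rho_nbhs] equi]] [cpsi _ psiT] x x' xx'.
have rho_ge0 a b : 0 <= rho a b.
  have := rhoD a b a; rewrite (rho0 a a).2 // (rhoC b a) -mulr2n.
  by rewrite pmulrn_lge0.
(* By [phase_disagree] the points differ in at most one place, and [N] lies beyond it. *)
have [N hN] : exists N : nat, forall k : int, (N%:Z <= k)%R ->
    (\val x : biseq) k = (\val x' : biseq) k.
  have [[k0 hk0]|no] := pselect (exists k,
      (\val x : biseq) k != (\val x' : biseq) k).
    exists `|k0|%N.+1 => k kN; apply/eqP; apply: contraT => ne.
    have ek : k = k0.
      have h' : has_phase (\val x') (phase (odometer_factor x)).
        by rewrite xx'; exact: phase_factor.
      exact: (phase_disagree (@phase_coherent _) (@phase_factor x) h' ne hk0).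
    lia.
  exists 0%N => k _; apply/eqP; apply: contraT => ne; case: no; by exists k.
apply/rho0/eqP; apply: contraT => ne.
have e0 : 0 < rho (psi x) (psi x') by rewrite lt_def ne rho_ge0.
have [d d0 hd] := equi _ e0.
have [p hp] := compact_seq_cluster (fun n => iter n T x) (@X_of_compact _).
have nB : nbhs (psi p) [set z | rho (psi p) z < d / 2].
  by apply/rho_nbhs; exists (d / 2) => //; exact: divr_gt0.
have /X_nbhs_agree[j jB] := cpsi p _ nB.
(* At times past [N + j] both iterates agree on the window of radius [j], so both are near [p]. The
   time is written [n.+1] for the iterate [Negz n] to undo it. *)
have [[|n] // nN pn] := hp _ (N + j).+1 (X_agree_nbhs j p).
have pn' : agree (fun i (x : X) => coord_label i (\val x)) j p (iter n.+1 T x').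
  move=> i ij; rewrite (pn i ij); congr pair; rewrite !val_iter; apply: hN; lia.
have {}jB1 := jB _ pn; have {}jB2 := jB _ pn'.
have close : rho (psi (iter n.+1 T x)) (psi (iter n.+1 T x')) < d.
  apply: le_lt_trans (rhoD _ (psi p) _) _.
  by rewrite (rhoC _ (psi p)) [d in _ < d]splitr ltrD.
have psi_iter k z : psi (iter k T z) = iter k G (psi z).
  by elim: k => [//|k IH]; rewrite !iterS psiT IH.
have GK k z : iter k (hinv G) (iter k G z) = z.
  by elim: k z => [//|k IH] z; rewrite iterSr iterS hfunK IH.
have := hd _ _ close (Negz n); rewrite /iterz !psi_iter !GK.
by rewrite ltxx.
Qed.

Lemma toeplitz_maximal_equicontinuous_factor :
  maximal_equicontinuous_factor R T S.
Proof.
split; [exact: X_dynamical_system|exact: odometer_equicontinuous|].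
exists odometer_factor; first exact: factor_is_factor.
move=> Z G psi eG fpsi; have fib := factor_fiber eG fpsi.
have [cpsi spsi psiT] := fpsi.
(* The section [g] need not be continuous; by [factor_fiber], [psi \o g] does not depend on its
   choice. *)
have [g gK] := choice factor_surj.
have psiE x : psi x = psi (g (odometer_factor x)) by apply: fib; rewrite gK.
exists (psi \o g); last by apply/funext => x; exact: psiE.
split.
(* Points tending to [y] with images outside [A] would have lifts clustering at a point of the fibre
   of [y], against the continuity of [psi]. *)
- move=> y A nA; apply/(nbhs_agree Y_compact r_nbhs r_sep).
  apply/not_existsP => no.
  have /choice[u uP] j : exists z, agree r j y z /\ ~ A (psi (g z)).
    have /existsNP[z /not_implyP h] : ~ agree r j y `<=` (psi \o g) @^-1` A.
      exact: no.
    by exists z.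
  have [p hp] := compact_seq_cluster (g \o u) (@X_of_compact _).
  have py : odometer_factor p = y.
    apply: r_sep => i.
    have [n ni /= e] :=
      hp _ i.+1 (factor_continuous (r_nbhs i (odometer_factor p))).
    by rewrite gK in e; rewrite -e; apply/esym; exact: (uP n).1.
  have np : nbhs p (psi @^-1` A) by apply: cpsi; rewrite psiE py.
  by have [n _ An] := hp _ 0%N np; exact: (uP n).2.
- apply/seteqP; split=> // z _.
  have [x _ <-] : range psi z by rewrite spsi.
  by exists (odometer_factor x); rewrite //= -psiE.
- by move=> y /=; rewrite -psiT [RHS]psiE factor_shift gK.
Qed.

End Odometer.

(** * Bratteli diagrams with a single vertex on each level *)

Section SingleVertexLevels.
Variable B : bratteli.
Hypothesis vertex1 : forall n, #|vertex B n.+1| = 1%N.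

Lemma edge_le_total n (e e' : edge B n) : edge_le e e' || edge_le e' e.
Proof.
have le1 : (#|vertex B n.+1| <= 1)%N by rewrite vertex1.
by rewrite edge_comparable; apply/eqP; exact: (fintype_le1P le1).
Qed.

(** The edges of a level form a chain, so this is the digit of [e], from 0 to [#|edge B n| - 1]. *)
Definition edge_rank n (e : edge B n) : nat := #|[pred e' | edge_lt e' e]|.

Lemma edge_lt_irr n (e : edge B n) : edge_lt e e = false.
Proof. by rewrite /edge_lt eqxx. Qed.

Lemma edge_lt_trans n : transitive (@edge_lt B n).
Proof.
move=> f e g /andP[ef lef] /andP[fg lfg]; apply/andP; split; last first.
  exact: edge_le_trans lef lfg.
apply: contra ef => /eqP eg; rewrite -eg in lfg.
by apply/eqP; apply: edge_le_anti; rewrite lef lfg.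
Qed.

Lemma edge_lt_total n (e f : edge B n) : e != f -> edge_lt e f || edge_lt f e.
Proof. by move=> ef; rewrite /edge_lt [f == e]eq_sym ef edge_le_total. Qed.

Lemma edge_rank_lt n (e : edge B n) : (edge_rank e < #|edge B n|)%N.
Proof.
apply: proper_card; apply/properP; split; first exact/subset_predT.
by exists e; rewrite // inE edge_lt_irr.
Qed.

Lemma edge_rank_mono n (e f : edge B n) :
  edge_lt e f -> (edge_rank e < edge_rank f)%N.
Proof.
move=> ef; apply: proper_card; apply/properP; split.
  by apply/fintype.subsetP => g; rewrite !inE => ge; exact: edge_lt_trans ge ef.
by exists e; rewrite !inE ?edge_lt_irr.
Qed.

Lemma edge_rank_inj n : injective (@edge_rank n).
Proof.
move=> e f ef; apply/eqP; apply: contraT => /edge_lt_total /orP[]/edge_rank_mono;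
by rewrite ef ltnn.
Qed.

Lemma edge_rank_succ n (e f : edge B n) :
  edge_succ e f -> edge_rank f = (edge_rank e).+1.
Proof.
move=> [ef efP]; rewrite /edge_rank (cardD1 e) inE /= ef add1n; congr S.
apply: eq_card => g; rewrite !inE.
have [->|ge] := eqVneq g e; first by rewrite edge_lt_irr.
apply/idP/idP => [gf|/edge_lt_trans->//].
have /orP[//|eg] := edge_lt_total ge.
by have := efP g; rewrite eg gf.
Qed.

Lemma edge_rank_max n (e : edge B n) :
  edge_max e -> (edge_rank e).+1 = #|edge B n|.
Proof.
move=> emax; rewrite [RHS](cardD1 e) inE add1n; congr S; apply: eq_card => g.
rewrite !inE andbT /edge_lt; case: eqVneq => //= ge.
have /orP[//|eg] := edge_le_total g e.
by rewrite (emax _ eg) eqxx in ge.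
Qed.

Lemma edge_rank_min n (e : edge B n) : edge_min e -> edge_rank e = 0%N.
Proof.
move=> emin; apply: eq_card0 => g; rewrite !inE; apply/negP => /andP[ge].
by move=> /emin eg; rewrite eg eqxx in ge.
Qed.

(** * Paths as numbers in a mixed base *)

Definition path_count (n : nat) : nat := \prod_(i < n) #|edge B i|.

Lemma path_countS n : path_count n.+1 = (path_count n * #|edge B n|)%N.
Proof. by rewrite /path_count big_ord_recr. Qed.

Lemma path_count_gt0 n : (0 < path_count n)%N.
Proof. by apply: prodn_gt0 => i; exact: edge_nonempty. Qed.

Lemma path_count_dvd m n : (m <= n)%N -> (path_count m %| path_count n)%N.
Proof.
move/subnK <-; elim: (n - m)%N => [//|k IH].
by rewrite addSn path_countS dvdn_mulr.
Qed.

Lemma path_count_leq m n : (m <= n)%N -> (path_count m <= path_count n)%N.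
Proof.
by move=> mn; apply: dvdn_leq (path_count_gt0 n) (path_count_dvd mn).
Qed.

(** The first [n] edges read as digits, least significant first, digit [i] taking [#|edge B i|]
    values. *)
Definition residue (n : nat) (x : path_space B) : nat :=
  \sum_(i < n) edge_rank (pedge x i) * path_count i.

Lemma residueS n x :
  residue n.+1 x = (residue n x + edge_rank (pedge x n) * path_count n)%N.
Proof. by rewrite /residue big_ord_recr. Qed.

Lemma residue_lt n x : (residue n x < path_count n)%N.
Proof.
elim: n => [|n IH]; first by rewrite /residue big_ord0 path_count_gt0.
rewrite residueS path_countS [X in (_ < X)%N]mulnC.
apply: (@leq_trans ((edge_rank (pedge x n)).+1 * path_count n)).
  by rewrite mulSn ltn_add2r.
by rewrite leq_mul2r edge_rank_lt orbT.
Qed.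

Lemma residue_mod m n x : (m <= n)%N ->
  residue m x = (residue n x %% path_count m)%N.
Proof.
move/subnK <-; elim: (n - m)%N => [|k IH].
  by rewrite modn_small ?residue_lt.
rewrite addSn residueS -modnDmr.
have /dvdnP[c ->] := path_count_dvd (leq_addl k m).
by rewrite mulnA modnMl addn0.
Qed.

Lemma residue_sep x y : (forall n, residue n x = residue n y) -> x = y.
Proof.
move=> h; apply: val_inj; apply: functional_extensionality_dep => n.
apply: edge_rank_inj; apply/eqP.
have := h n.+1; rewrite !residueS h => /addnI/eqP.
by rewrite eqn_pmul2r ?path_count_gt0.
Qed.

Lemma pedge_nbhs n (x : path_space B) : nbhs x [set y | pedge y n = pedge x n].
Proof.
have h : nbhs (\val x : edge_seq B)
    [set z : edge_seq B | z n = (\val x : edge_seq B) n].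
  apply: (@proj_continuous nat (fun n => discrete_topology (edge B n)) n
    (\val x) [set e | e = (\val x : edge_seq B) n]).
  by rewrite nbhs_principalE; apply/principal_filterP.
exact: (@initial_continuous (path_space B) (edge_seq B) set_val x _ h).
Qed.

Lemma residue_nbhs n x : nbhs x [set y | residue n y = residue n x].
Proof.
elim: n => [|n IH].
  by apply: (filterS _ filterT) => y _; rewrite /residue /= !big_ord0.
apply: filterS2 IH (pedge_nbhs n x) => y /= h hp.
by rewrite !residueS h hp.
Qed.

Lemma residue_max n x : (forall i, (i < n)%N -> edge_max (pedge x i)) ->
  (residue n x).+1 = path_count n.
Proof.
elim: n => [|n IH] mx; first by rewrite /residue /path_count !big_ord0.
rewrite residueS -addSn IH => [|i ni]; last exact/mx/ltnW.
by rewrite -mulSn edge_rank_max ?path_countS 1?mulnC //; exact: mx.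
Qed.

Lemma residue_min n x : (forall i, (i < n)%N -> edge_min (pedge x i)) ->
  residue n x = 0%N.
Proof. by move=> mn; apply: big1 => i _; rewrite edge_rank_min //; exact: mn. Qed.

(** The Vershik map adds 1 with carry: the maximal digits before the first nonmaximal one become 0,
    and that one increases. A carry beyond level [n] turns [path_count n - 1] into 0. *)
Lemma residue_vershik (lambda : path_space B -> path_space B) n x :
  vershik_map lambda ->
  residue n (lambda x) = ((residue n x).+1 %% path_count n)%N.
Proof.
move=> [lmax lsucc].
have wrap : (forall i, (i < n)%N -> edge_max (pedge x i)) ->
    (forall i, (i < n)%N -> edge_min (pedge (lambda x) i)) ->
    residue n (lambda x) = ((residue n x).+1 %% path_count n)%N.
  by move=> /residue_max -> /residue_min ->; rewrite modnn.
have [xmax|/existsNP ex] := pselect (path_max x).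
  by apply: wrap => i _; [exact: xmax|exact: lmax].
have {}ex : exists k, `[< ~ edge_max (pedge x k) >].
  by case: ex => k hk; exists k; apply/asboolP.
pose k := ex_minn ex.
have [kN kmin] : ~ edge_max (pedge x k) /\
    forall j, (j < k)%N -> edge_max (pedge x j).
  rewrite /k; case: ex_minnP => l /asboolP lN lmin; split=> // j jl.
  by apply: contrapT => /asboolP /lmin; rewrite leqNgt jl.
have [ksucc kmins keq] := lsucc x k kN kmin.
have [nk|kn] := leqP n k.
  by apply: wrap => i ni; [apply: kmin|apply: kmins]; exact: leq_trans ni nk.
suff e : residue n (lambda x) = (residue n x).+1.
  by rewrite -e modn_small // residue_lt.
rewrite -(subnKC kn); move: (n - k.+1)%N => d.
elim: d => [|d IH]; rewrite ?addn0.
  by rewrite !residueS (residue_min kmins) (edge_rank_succ ksucc) mulSn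
    -(residue_max kmin); lia.
by rewrite addnS (residueS (k.+1 + d)) IH (residueS (k.+1 + d)) keq // leq_addr.
Qed.

End SingleVertexLevels.

(* A bounded number of finite paths leaves only finitely many infinite ones. *)
Lemma path_count_unbounded (B : bratteli) (u : nat -> path_space B) M :
  (forall n, #|vertex B n.+1| = 1%N) -> injective u ->
  exists n, (M < path_count B n)%N.
Proof.
move=> vertex1 u_inj; apply: contrapT => /forallNP bound.
have bd n : (path_count B n <= M)%N by rewrite leqNgt; apply/negP/bound.
have ex : exists m, `[< exists n, path_count B n = m >].
  by exists (path_count B 0); apply/asboolP; exists 0%N.
have exM m : `[< exists n, path_count B n = m >] -> (m <= M)%N.
  by move=> /asboolP[n <-].
(* From the level [K] of largest count on, all counts are equal, so [residue K] determines a path;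
   the pigeonhole principle then contradicts the injectivity of [u]. *)
have [m /asboolP[K <-] Kmax] := ex_maxnP ex exM.
have inj_K (x y : path_space B) : residue K x = residue K y -> x = y.
  move=> xy; apply: (residue_sep vertex1) => n.
  have [nK|/ltnW Kn] := leqP n K; first by rewrite !(residue_mod _ nK) xy.
  have e : path_count B n = path_count B K.
    apply/eqP; rewrite eqn_leq; apply/andP; split; last exact: path_count_leq.
    by apply: Kmax; apply/asboolP; exists n.
  have eK (z : path_space B) : residue n z = residue K z.
    by rewrite (residue_mod z Kn) -e modn_small // residue_lt.
  by rewrite !eK.
pose f (i : 'I_(path_count B K).+1) : 'I_(path_count B K) :=
  Ordinal (residue_lt K (u i)).
have f_inj : injective f by move=> i j /(congr1 val) /inj_K /u_inj /val_inj.
by have := leq_card f f_inj; rewrite !card_ord ltnn.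
Qed.

Theorem theorem8p6 (R : realType) (Y : topologicalType) (S : homeo Y Y) :
  infinite_odometer S ->
  exists (V : nat -> bool) (hV : subshift (X_of V)),
    [/\ minimal_subshift (X_of V),
        symbolic_rank (X_of V) 2 &
        maximal_equicontinuous_factor R (subshift_map hV) S].
Proof.
move=> [[c] _ [B [_ vertex1 [lambda vershik [h [h_cont _ hS]]]]]].
have point_inj : injective (fun m => (fun n => n == m) : cantor_space).
  move=> m m' /(congr1 (fun z : cantor_space => z m)).
  by rewrite eqxx => /esym/eqP.
pose u m := h (hinv c (fun n => n == m)).
have u_inj : injective u.
  by move=> m m' /(can_inj (hfunK h)) /(can_inj (hinvK c)) /point_inj.
have Y_compact : compact [set: Y].
  have -> : [set: Y] = hinv c @` [set: cantor_space].
    by apply/seteqP; split=> // y _; exists (c y) => //; rewrite hfunK.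
  apply: continuous_compact cantor_space_compact.
  by apply: continuous_subspaceT; exact: hinv_continuous.
(* Telescoping: levels are skipped until the number of paths has at least tripled. *)
have /choice[next nextP] k : exists k', (k <= k')%N /\
    (3 * path_count B k <= path_count B k')%N.
  have [n hn] := path_count_unbounded (3 * path_count B k)%N vertex1 u_inj.
  exists (k + n)%N; split; first exact: leq_addr.
  exact: leq_trans (ltnW hn) (@path_count_leq B _ _ (leq_addl k n)).
pose kk j := iter j next 0%N.
pose P j := path_count B (kk j).
pose r j y := residue (kk j) (h y).
have P0 : P 0 = 1%N by rewrite /P /path_count big_ord0.
have P_dvd j : (P j %| P j.+1)%N by apply: path_count_dvd; exact: (nextP _).1.
have P_ge3 j : (3 * P j <= P j.+1)%N by exact: (nextP _).2.
(* The chosen levels strictly increase because the counts do; hence the residues at these levels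
   determine all the others. *)
have kk_ge j : (j <= kk j)%N.
  elim: j => // j IH; apply: leq_ltn_trans IH _.
  rewrite ltn_neqAle (nextP _).1 andbT; apply/eqP => e.
  by have := P_ge3 j; have := P_gt0 P0 P_ge3 j; rewrite /P -e; lia.
have r_nbhs j y : nbhs y [set z | r j z = r j y].
  exact: h_cont (residue_nbhs _ _).
have r_sep y z : (forall j, r j y = r j z) -> y = z.
  move=> yz; apply: (can_inj (hfunK h)); apply: (residue_sep vertex1) => n.
  by rewrite !(residue_mod _ (kk_ge n)) -!/(r n _) yz.
have r_coh j y : r j y = (r j.+1 y %% P j)%N.
  by apply: residue_mod; exact: (nextP _).1.
have r_S j y : r j (S y) = ((r j y).+1 %% P j)%N.
  by rewrite /r hS; exact: residue_vershik.
have Y_inhabited : inhabited Y by split; exact: hinv c (fun _ => false).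
exists (toeplitz P), (X_of_subshift _); split.
- exact: (X_of_toeplitz_minimal P0 P_dvd P_ge3 Y_compact Y_inhabited r_nbhs
    r_coh r_S).
- exact: (X_of_toeplitz_rank2 P0 P_dvd P_ge3 Y_compact Y_inhabited r_nbhs
    r_sep r_coh r_S).
- exact: (toeplitz_maximal_equicontinuous_factor P0 P_dvd P_ge3 Y_compact
    Y_inhabited r_nbhs r_sep r_coh r_S).
Qed.
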